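(* Fix a constant $K\ge 1$. There is a polynomial-time algorithm that, given two MSyDSs $\mathcal{S}_0$ and $\mathcal{S}_1$ on a common node set $V$, each having at most $K$ layers, in which every local function is a symmetric Boolean function and every master function is an arbitrary Boolean function, decides whether $\mathcal{S}_0$ and $\mathcal{S}_1$ are equivalent.
   Context: A multilayer synchronous dynamical system (MSyDS) $\mathcal{S}$ over $\mathbb{B}=\{0,1\}$ with $k\ge 1$ layers consists of: a finite node set $V$; undirected simple graphs $G_i=(V,E_i)$, $1\le i\le k$ (all layers share the node set $V$); for each layer $i$ and node $v$ a local function $f_{i,v}$ with output in $\mathbb{B}$ whose inputs are the states of the nodes in the closed neighborhood of $v$ in $G_i$ ($v$ and its neighbors in $G_i$); and for each node $v$ a master function $\psi_v:\mathbb{B}^k\to\mathbb{B}$. A configuration is a map $\mathcal{C}:V\to\mathbb{B}$; its successor is $\mathcal{C}'$ with $\mathcal{C}'(v)=\psi_v(f_{1,v}(\mathcal{C}),\dots,f_{k,v}(\mathcal{C}))$ for all $v$ (synchronous update), where $f_{i,v}(\mathcal{C})$ is $f_{i,v}$ evaluated on the states in $\mathcal{C}$ of the closed neighborhood of $v$ in $G_i$. The phase space is the directed graph on all configurations with an arc from each configuration to its successor. Two MSyDSs on the same node set are equivalent if their phase spaces are identical. A Boolean function is symmetric if its value depends only on the number of 1's among its inputs; a symmetric function with $q$ inputs is specified by its symmetry table, listing for each $j\in\{0,\dots,q\}$ the value when exactly $j$ inputs are 1. The input consists of the graphs (edge lists), the symmetry tables of the local functions, and the master functions (e.g., as truth tables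 on at most $K$ inputs); polynomial time is measured in the size of this input (in particular in $|V|$). *)

(* Defs.v *)
From mathcomp Require Import all_boot.

Inductive move := MLeft | MRight | MStay.

Record TM := {
  tm_Q : finType;
  tm_S : finType;
  tm_blank : tm_S;
  tm_in : bool -> tm_S;
  tm_q0 : tm_Q;
  tm_delta : tm_Q -> tm_S -> option (tm_Q * tm_S * move); (* None = halt *)
  tm_acc : pred tm_Q
}.

(* configuration: state, cells left of the head (nearest first),
   scanned cell, cells right of the head (nearest first);
   unlisted cells are blank *)
Record tconf (M : TM) := TConf {
  cq : tm_Q M; cl : seq (tm_S M); cc : tm_S M; cr : seq (tm_S M) }.
Arguments cq {M}. Arguments cl {M}. Arguments cc {M}. Arguments cr {M}.

Definition tm_init (M : TM) (w : seq bool) : tconf M :=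
  match map (tm_in M) w with
  | [::] => TConf M (tm_q0 M) [::] (tm_blank M) [::]
  | a :: r => TConf M (tm_q0 M) [::] a r
  end.

Definition tm_step (M : TM) (c : tconf M) : option (tconf M) :=
  match tm_delta M (cq c) (cc c) with
  | None => None
  | Some (q', s, m) =>
    Some match m with
    | MStay => TConf M q' (cl c) s (cr c)
    | MLeft => match cl c with
               | [::] => TConf M q' [::] (tm_blank M) (s :: cr c)
               | a :: l => TConf M q' l a (s :: cr c)
               end
    | MRight => match cr c with
               | [::] => TConf M q' (s :: cl c) (tm_blank M) [::]
               | a :: r => TConf M q' (s :: cl c) a r
               end
    end
  end.

Fixpoint tm_exec (M : TM) (t : nat) (c : tconf M) : option (tm_Q M) :=
  match tm_step M c with
  | None => Some (cq c)
  | Some c' => if t is t'.+1 then tm_exec M t' c' else None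
  end.

Definition tm_decides_within (M : TM) (w : seq bool) (t : nat) (P : Prop) :=
  exists q, tm_exec M t (tm_init M w) = Some q /\ (tm_acc M q <-> P).

Set Implicit Arguments. Unset Strict Implicit. Unset Printing Implicit Defensive.

Record msyds (n : nat) := MSyDS {
  nlayers : nat;
  layer : 'I_nlayers -> rel 'I_n;
  symtab : 'I_nlayers -> 'I_n -> seq bool;
  mastertab : 'I_n -> seq bool
}.
Arguments nlayers {n}. Arguments layer {n} m. Arguments symtab {n} m. Arguments mastertab {n} m.

Definition cnbhd n (S : msyds n) (i : 'I_(nlayers S)) (v : 'I_n) : {set 'I_n} :=
  [set u | (u == v) || layer S i v u].

Definition wf_msyds n (S : msyds n) : Prop :=
  [/\ 0 < nlayers S,
      (forall i, symmetric (layer S i) /\ irreflexive (layer S i)),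
      (forall i v, size (symtab S i v) = #|cnbhd i v|.+1) &
      (forall v, size (mastertab S v) = 2 ^ nlayers S)].

Definition config n := {ffun 'I_n -> bool}.

Definition local_val n (S : msyds n) (i : 'I_(nlayers S)) (v : 'I_n)
  (C : config n) : bool :=
  nth false (symtab S i v) #|[set u in cnbhd i v | C u]|.

(* master function psi_v applied to (b_1..b_k): truth-table entry at
   index sum_i b_i 2^(i-1) *)
Definition succ n (S : msyds n) (C : config n) : config n :=
  [ffun v => nth false (mastertab S v)
     (\sum_(i < nlayers S) nat_of_bool (local_val i v C) * 2 ^ i)].

Definition phase_arc n (S : msyds n) : rel (config n) :=
  fun C C' => C' == succ S C.

Definition equivalent n (S0 S1 : msyds n) : Prop :=
  forall C C' : config n, phase_arc S0 C C' = phase_arc S1 C C'.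

Inductive etree := EBit of bool | ENode of seq etree.

(* bit b |-> 0b ; node |-> 10 <children> 11  (prefix-free) *)
Fixpoint ebits (t : etree) : seq bool :=
  match t with
  | EBit b => [:: false; b]
  | ENode ts => [:: true; false] ++
      (fix go (l : seq etree) := match l with
        | [::] => [::] | x :: l' => ebits x ++ go l' end) ts ++ [:: true; true]
  end.

Fixpoint bin_aux (fuel m : nat) : seq bool :=
  if fuel is f.+1 then (if m is 0 then [::] else odd m :: bin_aux f m./2)
  else [::].
Definition enc_nat (m : nat) : etree := ENode (map EBit (bin_aux m m)).

Definition enc_bools (s : seq bool) : etree := ENode (map EBit s).

Definition enc_msyds n (S : msyds n) : etree :=
  ENode [:: enc_nat n; enc_nat (nlayers S);
    ENode [seq ENode [seq ENode [:: enc_nat u; enc_nat v]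
                       | u : 'I_n <- enum 'I_n,
                         v : 'I_n <- [seq x : 'I_n <- enum 'I_n | (u < x) && layer S i u x]]
          | i <- enum 'I_(nlayers S)];
    ENode [seq ENode [seq enc_bools (symtab S i v) | v <- enum 'I_n]
          | i <- enum 'I_(nlayers S)];
    ENode [seq enc_bools (mastertab S v) | v <- enum 'I_n]].

Definition enc_instance n (S0 S1 : msyds n) : seq bool :=
  ebits (ENode [:: enc_msyds S0; enc_msyds S1]).

(* Main.v *)
(** A program with boundedly many pointers into the input is simulated by a
Turing machine that marks the pointer positions on its tape.  Such a program has
only polynomially many configurations, so halting alone bounds its running time
polynomially: every function below only needs to be shown computable by some
terminating pointer program.

[S0] and [S1] are inequivalent iff their successors differ at some node [v].
Classify the nodes [u] by the set of those (at most [2K]) closed neighborhoods of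
[v] that contain [u].  The local functions are symmetric, so only the number of
1's in each of the at most [2 ^ (2K)] classes matters, and every vector of such
numbers is attained by a configuration "[u] is 1 iff [u] is below the threshold
of its class".  It therefore suffices to loop over all [v] and all threshold
vectors, which is a bounded number of pointers. *)

From HB Require Import structures.
Require Import Defs.
From mathcomp Require Import all_boot zify.

Set Implicit Arguments.
Unset Strict Implicit.
Unset Printing Implicit Defensive.

(** * Pointer machines on a Turing machine *)

(** Thresholds are looped over, rather than the class counts themselves, because no vector of
    thresholds is infeasible: each one describes a configuration, and membership of a node in it is
    a single comparison. The classes are taken with respect to both systems at once, since one
    configuration must feed both successors. The obstacle is that a pointer holds no value above
    [size w]. Node numbers are therefore compared with binary digits of the input instead of being
    decoded, and quantities bounded in terms of [K] alone, such as class numbers and indices into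
    master tables, are never held in a register: they are compiled into decision trees or into
    repeated skips over subtrees. The programs are not written out; [calc] is shown to be closed
    under binding, branching, search and counting, and the procedure is assembled from these closure
    properties. *)

Inductive test := TBit of nat | TEnd of nat | TEq of nat & nat.

Inductive act :=
  AHalt of bool | ANop | AInc of nat | AZero of nat | ATest of test.

Definition store := nat -> nat.

Definition upd (s : store) r v : store := fun x => if x == r then v else s x.

Definition teval (w : seq bool) (s : store) t :=
  match t with
  | TBit r => nth false w (s r)
  | TEnd r => s r == size w
  | TEq r r' => s r == s r'
  end.

(** [AInc] saturates at [size w], the first cell after the input. Hence stores stay in a finite
    range, which the count of configurations needs. *)
Definition aeval (w : seq bool) (s : store) a : bool * store :=
  match a with
  | AInc r => (false, if s r < size w then upd s r (s r).+1 else s)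
  | AZero r => (false, upd s r 0)
  | ATest t => (teval w s t, s)
  | _ => (false, s)
  end.

(** The register whose mark the head seeks. One seek suffices for [TEq r r']: the pointers agree iff
    the mark of [r'] lies on the cell of [r]. *)
Definition akey a :=
  match a with
  | AInc r | AZero r => r
  | ATest t => match t with TBit r | TEnd r | TEq r _ => r end
  | _ => 0
  end.

Definition aregs a :=
  match a with
  | AInc r | AZero r | ATest (TBit r) | ATest (TEnd r) => r
  | ATest (TEq r r') => maxn r r'
  | _ => 0
  end.

(** In [MPut] the mark of an incremented register has been lifted and goes down on the next cell; in
    [MRetZ] a lifted mark is carried back to cell 0. *)
Inductive mode := MHome | MSeek | MPut | MRet | MRetZ.

Definition mode_code m : 'I_5 :=
  match m with
  | MHome => inord 0 | MSeek => inord 1 | MPut => inord 2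
  | MRet => inord 3 | MRetZ => inord 4
  end.

Definition mode_decode (i : 'I_5) :=
  nth MHome [:: MHome; MSeek; MPut; MRet; MRetZ] i.

Lemma mode_codeK : cancel mode_code mode_decode.
Proof. by case; rewrite /mode_decode /= inordK. Qed.

HB.instance Definition _ := Finite.copy mode (can_type mode_codeK).

(** * Runs of a Turing machine, with the tape seen as a function of the position *)

Fixpoint msteps (M : TM) n (c : tconf M) : option (tconf M) :=
  if n is n'.+1 then obind (@msteps M n') (tm_step M c) else Some c.

Lemma msteps_add M n m (c c1 : tconf M) :
  msteps n c = Some c1 -> msteps (n + m) c = msteps m c1.
Proof.
elim: n c => [|n IHn] c /=; first by case=> ->.
by case: (tm_step _ c) => //= c2 /IHn.
Qed.

Lemma tm_exec_msteps M n t (c c1 : tconf M) :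
  msteps n c = Some c1 -> tm_step M c1 = None -> n <= t ->
  tm_exec M t c = Some (cq c1).
Proof.
move=> + halt; elim: n t c => [|n IHn] t c /=.
  by case=> ->; case: t => [|t] _ /=; rewrite halt.
case: t => // t /=; case: (tm_step _ c) => //= c2 e; exact: IHn.
Qed.

Section Tape.
Variable M : TM.

Definition tape (c : tconf M) := rev (cl c) ++ cc c :: cr c.

(** Positions are counted from the leftmost listed cell, so [p] is the length of the left list. This
    stays meaningful because the simulation never moves left of cell 0; blanks listed at the right
    end are invisible to [nth]. *)
Definition rep (c : tconf M) q p (T : nat -> tm_S M) :=
  [/\ cq c = q, size (cl c) = p & nth (tm_blank M) (tape c) =1 T].

Definition reaches n c q p T := exists2 c', msteps n c = Some c' & rep c' q p T.

Lemma rep_cell c q p T : rep c q p T -> cc c = T p.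
Proof. by case=> _ <- <-; rewrite /tape nth_cat size_rev ltnn subnn. Qed.

Lemma reaches_add n m c c1 q p T :
  msteps n c = Some c1 -> reaches m c1 q p T -> reaches (n + m) c q p T.
Proof. by move=> e [c2 e2 r2]; exists c2; rewrite ?(msteps_add _ e). Qed.

Definition tupd (T : nat -> tm_S M) p x := fun j => if j == p then x else T j.

Definition newpos p m := match m with MLeft => p.-1 | MRight => p.+1 | MStay => p end.

Lemma rep_step c q p T q' x m :
    rep c q p T -> tm_delta M q (T p) = Some (q', x, m) ->
    (m = MLeft -> 0 < p) ->
  exists2 c', tm_step M c = Some c' & rep c' q' (newpos p m) (tupd T p x).
Proof.
move=> rc; have ec := rep_cell rc; case: rc => eq sp eT dE mp.
rewrite /tm_step eq ec dE; eexists; first by [].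
have uT j : tupd T p x j = nth (tm_blank M) (rev (cl c) ++ x :: cr c) j.
  rewrite /tupd -eT /tape !nth_cat size_rev sp; case: (ltngtP j p) => // [jp|->].
    by case: (j - p) (subn_gt0 p j) => //; rewrite jp.
  by rewrite subnn.
case: m mp {dE} => [/(_ erefl) p0|_|_] /=.
- case: (cl c) sp uT p0 => [|a l] /= <- uT //.
  split=> // j; rewrite uT /tape /=.
  by rewrite rev_cons cat_rcons.
- case: (cr c) uT => [|a l] uT; split; rewrite //= ?sp // => j; rewrite uT /tape /=.
    (* Moving right off the listed cells appends a blank, which is also the default of [nth]. *)
    rewrite rev_cons cat_rcons [LHS](_ : _ = nth (tm_blank M) (rcons (rev (cl c) ++ [:: x])
        (tm_blank M)) j).
      by rewrite nth_rcons_default.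
    by rewrite -cats1 -catA.
  by rewrite rev_cons cat_rcons.
- by split.
Qed.

Lemma rep_ext c q p T T' : rep c q p T -> T =1 T' -> rep c q p T'.
Proof. by case=> ? ? e e'; split=> // j; rewrite e. Qed.

Lemma reaches_step n c q p T q' x m p' T' q2 :
    rep c q p T -> tm_delta M q (T p) = Some (q', x, m) ->
    (m = MLeft -> 0 < p) ->
    (forall c', rep c' q' (newpos p m) (tupd T p x) -> reaches n c' q2 p' T') ->
  reaches n.+1 c q2 p' T'.
Proof.
move=> rc dE mp H; have [c1 e1 r1] := rep_step rc dE mp.
have [c2 e2 r2] := H _ r1; exists c2 => //.
by rewrite /= e1.
Qed.

Lemma reaches1 c q p T q' x m p' T' :
    rep c q p T -> tm_delta M q (T p) = Some (q', x, m) ->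
    (m = MLeft -> 0 < p) -> p' = newpos p m -> tupd T p x =1 T' ->
  reaches 1 c q' p' T'.
Proof.
move=> rc dE mp -> eT; have [c1 e1 r1] := rep_step rc dE mp.
by exists c1; [rewrite /= e1 | exact: rep_ext r1 eT].
Qed.

Lemma tupd_id T p : tupd T p (T p) =1 T.
Proof. by move=> j; rewrite /tupd; case: eqP => // ->. Qed.

End Tape.

(** * Simulation of pointer instructions by marks on the tape *)

Section Simulation.
Variables (K : finType) (k0 : K) (knext : K -> bool -> K) (kact : K -> act).
Variable h : nat.

(** The input bit is kept beside the marks; it is [None] on blank cells, which is how the end of the
    input is recognized. *)
Definition sym := (bool * option bool * {set 'I_h.+1})%type.
(** [None] is the initial state: its only transition flags cell 0 and puts all marks there, as all
    registers start at 0. *)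
Definition tstate := option (mode * K).

Definition tsym t (ct : option bool) (mk : {set 'I_h.+1}) :=
  match t with
  | TBit _ => ct == Some true
  | TEnd _ => ct == None
  | TEq _ r => inord r \in mk
  end.

(* Cell 0 carries the flag [hm], and pointer [r] is a mark on the cell it points
   to.  Each instruction starts at cell 0, seeks the mark of its key register, and
   returns to cell 0. *)
Definition sim_delta (q : tstate) (x : sym) : option (tstate * sym * move) :=
  let: (hm, ct, mk) := x in
  match q with
  | None => Some (Some (MHome, k0), (true, ct, setT), MStay)
  | Some (m, k) =>
    let key : 'I_h.+1 := inord (akey (kact k)) in
    match m with
    | MHome => match kact k with
               | AHalt _ => None
               | ANop => Some (Some (MHome, knext k false), x, MStay)
               | _ => Some (Some (MSeek, k), x, MStay)
               end
    | MSeek =>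
      if key \in mk then
        match kact k with
        | AInc _ => if ct is None then Some (Some (MRet, knext k false), x, MStay)
                    else Some (Some (MPut, k), (hm, ct, mk :\ key), MRight)
        | AZero _ => Some (Some (MRetZ, k), (hm, ct, mk :\ key), MStay)
        | ATest t => Some (Some (MRet, knext k (tsym t ct mk)), x, MStay)
        | _ => None
        end
      else Some (q, x, MRight)
    | MPut => Some (Some (MRet, knext k false), (hm, ct, key |: mk), MStay)
    | MRet => if hm then Some (Some (MHome, k), x, MStay) else Some (q, x, MLeft)
    | MRetZ => if hm then Some (Some (MHome, knext k false), (hm, ct, key |: mk), MStay)
               else Some (q, x, MLeft)
    end
  end.

Definition sim_acc (q : tstate) :=
  if q is Some (MHome, k) then if kact k is AHalt true then true else false
  else false.

Definition sim_TM : TM := {|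
  tm_Q := tstate; tm_S := sym;
  tm_blank := (false, None, set0); tm_in := fun b => (false, Some b, set0);
  tm_q0 := None; tm_delta := sim_delta; tm_acc := sim_acc |}.

Variable w : seq bool.

Definition cell (s : store) (j : nat) : tm_S sim_TM :=
  (j == 0, onth w j, [set r : 'I_h.+1 | s r == j]).

Lemma seek_reaches m c k p T :
    @rep sim_TM c (Some (MSeek, k)) p T ->
    (forall j, p <= j < p + m -> inord (akey (kact k)) \notin (T j).2) ->
  @reaches sim_TM m c (Some (MSeek, k)) (p + m) T.
Proof.
elim: m c p => [|m IHm] c p rc nT; first by exists c; rewrite ?addn0.
apply: (@reaches_step sim_TM _ _ _ _ _ (Some (MSeek, k)) (T p) MRight _ _ _ rc) => //.
  have := nT p; rewrite leqnn addnS ltnS leq_addr => /(_ isT) /=.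
  by case: (T p) => [[hm ct] mk] /= /negbTE->.
move=> c' rc'; rewrite -addSnnS; apply: IHm => [|j Hj].
  exact: rep_ext rc' (tupd_id _ _).
by apply: nT; lia.
Qed.

Lemma ret_reaches c k md p T :
    md = MRet \/ md = MRetZ ->
    @rep sim_TM c (Some (md, k)) p T ->
    (forall j, (T j).1.1 = (j == 0)) ->
  @reaches sim_TM p c (Some (md, k)) 0 T.
Proof.
move=> Hm; elim: p c => [|p IHp] c rc nT; first by exists c.
apply: (@reaches_step sim_TM _ _ _ _ _ (Some (md, k)) (T p.+1) MLeft _ _ _ rc) => //.
  have := nT p.+1; case: (T p.+1) => [[hm ct] mk] /= ->.
  by case: Hm => ->.
move=> c' rc'; apply: IHp => //.
exact: rep_ext rc' (tupd_id _ _).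
Qed.

Definition inrange (s : store) := forall r, s r <= size w.

Definition mstep (x : K * store) : K * store :=
  let: (b, s') := aeval w x.2 (kact x.1) in (knext x.1 b, s').

Lemma tsym_cell s t : inrange s -> aregs (ATest t) <= h ->
  let x := cell s (s (akey (ATest t))) in tsym t x.1.2 x.2 = teval w s t.
Proof.
move=> Hs; case: t => [r|r|r r'] /= Hr.
- have [e|l] := leqP (size w) (s r).
    by rewrite onth_default // nth_default.
  by rewrite onthE (nth_map false) //; case: (nth _ _ _).
- have := Hs r; rewrite leq_eqVlt => /orP[/eqP e|l].
    by rewrite e onth_default // !eqxx.
  by rewrite onthE (nth_map false) // ltn_eqF.
- by rewrite inE inordK 1?eq_sym // ltnS (leq_trans (leq_maxr r r')).
Qed.

Lemma aregs_key a : akey a <= aregs a.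
Proof. by case: a => //= -[] //= r r'; rewrite leq_maxl. Qed.

(** The bound accounts for one sweep out to the mark and one back, over at most [size w] cells each,
    and a constant number of further steps. *)
Lemma macro_step c k s :
    @rep sim_TM c (Some (MHome, k)) 0 (cell s) -> inrange s ->
    aregs (kact k) <= h -> (forall b, kact k <> AHalt b) ->
  exists2 n, n <= 2 * size w + 6 &
    @reaches sim_TM n c (Some (MHome, (mstep (k, s)).1)) 0 (cell (mstep (k, s)).2).
Proof.
move=> rc Hs Hr nH; rewrite /mstep /=.
have [eN|nN] : kact k = ANop \/ kact k <> ANop by case: (kact k); by [left|right].
  exists 1; first by rewrite addnC.
  apply: (@reaches_step sim_TM _ _ _ _ _ (Some (MHome, knext k false)) (cell s 0) MStay _ _ _ rc).
  - by rewrite /= eN.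
  - by [].
  - move=> c' rc'; exists c' => //; rewrite eN /=; exact: rep_ext rc' (tupd_id _ _).
set key : 'I_h.+1 := inord (akey (kact k)).
have hk : akey (kact k) <= h by apply: leq_trans (aregs_key _) Hr.
have vk : key = akey (kact k) :> nat by rewrite inordK.
have {rc} [c1 e1 r1] : @reaches sim_TM 1 c (Some (MSeek, k)) 0 (cell s).
  apply: (@reaches_step sim_TM _ _ _ _ _ (Some (MSeek, k)) (cell s 0) MStay _ _ _ rc) => //.
    by rewrite /=; case: (kact k) nH nN => // b /(_ b).
  move=> c' rc'; exists c' => //; exact: rep_ext rc' (tupd_id _ _).
have [c2 e2 r2] : @reaches sim_TM (s (akey (kact k))) c1 (Some (MSeek, k)) (s (akey (kact k)))
    (cell s).
  rewrite -{2}(add0n (s _)); apply: seek_reaches => // j.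
  by rewrite add0n => /andP[_ lj]; rewrite inE -/key vk gtn_eqF.
have Hp := Hs (akey (kact k)).
have keyin : key \in (cell s (s (akey (kact k)))).2 by rewrite inE vk.
have e12 := msteps_add (s (akey (kact k))) e1; rewrite e2 in e12.
(* Common end of increments and tests: [n] steps at the key cell, then the way home. For [n = 2] the
   mark was put down one cell further right, hence the offset [n.-1]. *)
have ret n c3 k' T : n <= 2 -> msteps n c2 = Some c3 ->
     @rep sim_TM c3 (Some (MRet, k')) (s (akey (kact k)) + n.-1) T -> T =1 cell (aeval w s
         (kact k)).2 ->
     k' = knext k (aeval w s (kact k)).1 ->
    exists2 n, n <= 2 * size w + 6 &
      @reaches sim_TM n c (Some (MHome, k')) 0 (cell (aeval w s (kact k)).2).
  move=> n2 e3 r3 eT _.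
  have e13 := msteps_add n e12; rewrite e3 in e13.
  have r3' := rep_ext r3 eT.
  have [c4 e4 r4] := ret_reaches (or_introl erefl) r3' (fun=> erefl).
  have e14 := msteps_add (s (akey (kact k)) + n.-1) e13; rewrite e4 in e14.
  exists (1 + s (akey (kact k)) + n + (s (akey (kact k)) + n.-1) + 1); first by lia.
  apply: (reaches_add e14).
  apply: (@reaches_step sim_TM _ _ _ _ _ (Some (MHome, k')) (cell (aeval w s (kact k)).2 0)
      MStay _ _ _ r4) => //.
  by move=> c5 r5; exists c5 => //; apply: rep_ext r5 (tupd_id _ _).
have key_eq (r : 'I_h.+1) : (r == key) = (val r == akey (kact k)) by rewrite -val_eqE /= vk.
case E: (kact k) => [b||r|r|t]; first by case: (nH b).
- by case: nN.
- move: ret keyin key_eq r2 Hp hk; have kE : inord (akey (kact k)) = key by []; rewrite E /= in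
    kE *; move=> ret keyin key_eq r2 Hp hk.
  have [lt|ge] := ltnP (s r) (size w).
    rewrite lt /= in ret *.
    have [x0 xE] : exists x0, onth w (s r) = Some x0.
      by rewrite onthE (nth_map false) //; eexists.
    have [c3 e3 r3] : @reaches sim_TM 1 c2 (Some (MPut, k)) (s r).+1
        (@tupd sim_TM (cell s) (s r) (s r == 0, onth w (s r), (cell s (s r)).2 :\ key)).
      apply: (@reaches1 sim_TM _ _ _ _ _ (s r == 0, onth w (s r), (cell s (s r)).2 :\ key)
          MRight _ _ r2) => //.
      by rewrite /= E /= kE keyin xE.
    have [c4 e4 r4] : @reaches sim_TM 1 c3 (Some (MRet, knext k false)) (s r).+1 
          (cell (upd s r (s r).+1)).
      apply: (@reaches1 sim_TM _ _ _ _ _ (false, onth w (s r).+1, key |: (cell s (s r).+1).2)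
          MStay _ _ r3) => //.
        by rewrite /= /tupd gtn_eqF //= E /= kE.
      move=> j; rewrite /tupd; case: eqP => [->|/eqP jn].
        rewrite /cell; congr (_, _); apply/setP=> a; rewrite !inE key_eq /upd.
        by case: eqP => //= _; rewrite eqxx.
      case: eqP => [->|/eqP jn'].
        rewrite /cell; congr (_, _); apply/setP=> a; rewrite !inE key_eq /upd.
        by case: (val a =P r) => //= _; rewrite gtn_eqF.
      rewrite /cell; congr (_, _); apply/setP=> a; rewrite !inE /upd.
      by case: (val a =P r) => //= ->; rewrite ![_ == j]eq_sym (negbTE jn) (negbTE jn').
    apply: (ret 2 c4 _ _ _ _ _ _ erefl) => //.
    - by rewrite (msteps_add 1 e3).
    - by rewrite /= addn1; exact: r4.
  have xE : onth w (s r) = None by rewrite onth_default.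
  rewrite [_ < _]ltnNge ge /= in ret *.
  have [c3 e3 r3] : @reaches sim_TM 1 c2 (Some (MRet, knext k false)) (s r) (cell s).
    apply: (@reaches1 sim_TM _ _ _ _ _ (cell s (s r)) MStay _ _ r2) => //.
      by rewrite /= E /= kE keyin xE.
    exact: tupd_id.
  by apply: (ret 1 _ _ (cell s) _ e3); rewrite ?addn0.
- have e12' : msteps (1 + s r) c = Some c2 by rewrite -e12 E.
  move: ret keyin key_eq r2 Hp hk; have kE : inord (akey (kact k)) = key by []; rewrite E /= in
      kE *; move=> _ keyin key_eq r2 Hp hk.
  (* While the mark is lifted the tape encodes no store, so zeroing needs its own way home. *)
  set T3 := @tupd sim_TM (cell s) (s r) (s r == 0, onth w (s r), (cell s (s r)).2 :\ key).
  have [c3 e3 r3] : @reaches sim_TM 1 c2 (Some (MRetZ, k)) (s r) T3.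
    apply: (@reaches1 sim_TM _ _ _ _ _ (s r == 0, onth w (s r), (cell s (s r)).2 :\ key) MStay
        _ _ r2) => //.
    by rewrite /= E /= kE keyin.
  have T30 j : (T3 j).1 = (j == 0, onth w j) by rewrite /T3 /tupd; case: eqP => // ->.
  have e13 := msteps_add 1 e12'; rewrite e3 in e13.
  have [|c4 e4 r4] := ret_reaches (or_intror erefl) r3; first by move=> j; rewrite T30.
  have e14 := msteps_add (s r) e13; rewrite e4 in e14.
  exists (1 + s r + 1 + s r + 1); first by lia.
  apply: (reaches_add e14).
  apply: (@reaches1 sim_TM _ _ _ _ _ (true, (T3 0).1.2, key |: (T3 0).2) MStay _ _ r4) => //.
    by have := T30 0; case: (T3 0) => -[a b] c' /= [-> _]; rewrite E /= kE.
  move=> j; rewrite /tupd T30; case: eqP => [->|/eqP jn].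
    rewrite /cell; congr (_, _); apply/setP=> a; rewrite !inE key_eq /upd.
    case: (val a =P r) => //= ar; rewrite /T3 /tupd.
    by case: eqP => [<-|]; rewrite !inE // key_eq; case: (val a =P r) ar.
  rewrite /T3 /tupd; case: (j =P s r) jn => [-> jn|/eqP jn' jn];
    rewrite /cell; congr (_, _); apply/setP=> a; rewrite !inE ?key_eq /upd;
    case: (val a =P r) => //= ar; rewrite ?ar.
  - by rewrite eq_sym (negbTE jn).
  - by rewrite [s r == j]eq_sym (negbTE jn') [0 == j]eq_sym (negbTE jn).
- move: ret keyin key_eq r2 Hp hk; have kE : inord (akey (kact k)) = key by []; rewrite E /= in
    kE *; move=> ret keyin key_eq r2 Hp hk.
  have [c3 e3 r3] : @reaches sim_TM 1 c2 (Some (MRet, knext k (teval w s t))) (s (akey (ATest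
      t))) (cell s).
    apply: (@reaches1 sim_TM _ _ _ _ _ (cell s (s (akey (ATest t)))) MStay _ _ r2) => //.
      rewrite E in Hr; have := tsym_cell Hs Hr => /= <-.
      by rewrite /= E /= kE keyin.
    exact: tupd_id.
  by apply: (ret 1 _ _ (cell s) _ e3); rewrite ?addn0.
Qed.

Hypothesis regs_le : forall k, aregs (kact k) <= h.
Hypothesis knext_halt : forall k b b', kact k = AHalt b -> knext k b' = k.

Definition halted (x : K * store) b := kact x.1 = AHalt b.

Lemma mstep_inrange x : inrange x.2 -> inrange (mstep x).2.
Proof.
case: x => k s Hs; rewrite /mstep /=; case: (kact k) => [b||r|r|t] //= r'.
- by case: ifP => // lt; rewrite /upd; case: eqP => // ->.
- by rewrite /upd; case: eqP.
Qed.

Lemma iter_inrange i x : inrange x.2 -> inrange (iter i mstep x).2.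
Proof. by move=> Hx; elim: i => //= i; apply: mstep_inrange. Qed.

Lemma init_reaches :
  @reaches sim_TM 1 (tm_init sim_TM w) (Some (MHome, k0)) 0 (cell (fun=> 0)).
Proof.
pose T0 := nth (tm_blank sim_TM) (map (tm_in sim_TM) w).
have r0 : @rep sim_TM (tm_init sim_TM w) None 0 T0.
  by rewrite /tm_init /T0; case: w => [|a l]; split=> // j; rewrite /tape /=; case: j => // -[].
apply: (@reaches1 sim_TM _ _ _ _ _ (true, onth w 0, setT) MStay _ _ r0) => //.
  by rewrite /T0; case: w.
case=> [|j]; rewrite /tupd /cell /= /T0.
  by congr (_, _); apply/setP=> a; rewrite !inE.
have -> : [set r : 'I_h.+1 | 0 == j.+1] = set0 by apply/setP=> a; rewrite !inE.
have [lt|ge] := ltnP j.+1 (size w).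
  by rewrite (nth_map false) //= -[RHS]/(_, onth w j.+1, _) onthE (nth_map false).
by rewrite nth_default ?size_map // -[RHS]/(_, onth w j.+1, _) onth_default.
Qed.

Lemma run_reaches t c x :
    @rep sim_TM c (Some (MHome, x.1)) 0 (cell x.2) -> inrange x.2 ->
    (forall i, i < t -> forall b, ~ halted (iter i mstep x) b) ->
  exists2 n, n <= t * (2 * size w + 6) &
    @reaches sim_TM n c (Some (MHome, (iter t mstep x).1)) 0 (cell (iter t mstep x).2).
Proof.
move=> rc Hx; elim: t => [|t IHt] nH; first by exists 0 => //; exists c.
have [|n ln [c1 e1 r1]] := IHt; first by move=> i lt; apply: nH; rewrite ltnS ltnW.
have [|m lm rm] := @macro_step c1 (iter t mstep x).1 (iter t mstep x).2 r1 (iter_inrange _ Hx)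
    (regs_le _).
  exact: nH.
exists (n + m); first by rewrite mulSn addnC leq_add.
by apply: (reaches_add e1); move: rm; rewrite -surjective_pairing.
Qed.

(** A store is a function on all of [nat]; only its restriction to the registers up to [h] leaves
    finitely many configurations to count. *)
Definition abs (x : K * store) : K * {ffun 'I_h.+1 -> 'I_(size w).+1} :=
  (x.1, [ffun r : 'I_h.+1 => inord (x.2 r)]).

Lemma abs_eq x y : inrange x.2 -> inrange y.2 -> abs x = abs y ->
  x.1 = y.1 /\ forall r, r <= h -> x.2 r = y.2 r.
Proof.
move=> Hx Hy [-> /ffunP e]; split=> // r; rewrite -ltnS => lr.
have := congr1 val (e (Ordinal lr)); rewrite !ffunE /= !inordK //.
- exact: Hy.
- exact: Hx.
Qed.

(** A step reads and writes only registers up to [h], so it descends to the finite abstraction. *)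
Lemma abs_mstep x y : inrange x.2 -> inrange y.2 -> abs x = abs y ->
  abs (mstep x) = abs (mstep y).
Proof.
move=> Hx Hy /(abs_eq Hx Hy); case: x y {Hx Hy} => [k s] [k' s'] /= [<- e].
have := regs_le k; rewrite /mstep /=.
have ee s1 s2 : (forall r, r <= h -> s1 r = s2 r) -> forall k, abs (k, s1) = abs (k, s2).
  by move=> es k1; congr (_, _); apply/ffunP=> r; rewrite !ffunE /= es // -ltnS.
case: (kact k) => [b||r|r|t] //= lr; try exact: ee.
- rewrite (e r lr); case: ifP => _; apply: ee => // r' lr'.
  by rewrite /upd; case: eqP => // _; apply: e.
- by apply: ee => r' lr'; rewrite /upd; case: eqP => // _; apply: e.
- have -> : teval w s t = teval w s' t; last exact: ee.
  by case: t lr => [r1|r1|r1 r2] /= lr; rewrite !e //; move: lr; rewrite geq_max => /andP[].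
Qed.

(* Before the first halt no two configurations agree on the registers up to [h]:
   otherwise the computation would halt earlier. *)
Lemma halt_bound t x b : inrange x.2 -> halted (iter t mstep x) b ->
  exists t' b', [/\ t' <= #|K| * (size w).+1 ^ h.+1, halted (iter t' mstep x) b'
    & forall i, i < t' -> forall b'', ~ halted (iter i mstep x) b''].
Proof.
move=> Hx Ht.
pose hb (x : K * store) := if kact x.1 is AHalt _ then true else false.
have hbP y : reflect (exists b, halted y b) (hb y).
  rewrite /hb /halted; case: (kact y.1) => [b'||r|r|t0]; constructor; try (by case).
  by exists b'.
have ex : exists i, hb (iter i mstep x) by exists t; apply/hbP; exists b.
case: (ex_minnP ex) => m /hbP[b' hm] minm.
exists m, b'; split=> // [|i im b'' hi]; last first.
  by have := minm i; rewrite leqNgt im => /(_ _)/negP; apply => //; apply/hbP; exists b''.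
pose f (i : 'I_m.+1) := abs (iter i mstep x).
have finj : injective f.
  suff H (i j : 'I_m.+1) : i < j -> f i <> f j.
    move=> i j e; apply/val_inj; case: (ltngtP i j) => // /H; first by rewrite e.
    by rewrite e.
  move=> ij e.
  have shift d : abs (iter (d + i) mstep x) = abs (iter (d + j) mstep x).
    elim: d => // d IHd; rewrite !addSn !iterS.
    by apply: abs_mstep IHd; apply: iter_inrange.
  have jm : j <= m by rewrite -ltnS.
  have := shift (m - j); rewrite subnK // => /(congr1 fst) /= ek.
  have := minm (m - j + i); rewrite leqNgt => /(_ _)/negP; apply; last by lia.
  by apply/hbP; exists b'; rewrite /halted ek.
have := leq_card _ finj; rewrite card_ord card_prod card_ffun !card_ord.
exact: leq_trans.
Qed.

Lemma halted_iter i x b : halted x b -> iter i mstep x = x.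
Proof.
move=> hx; elim: i => //= i ->; case: x hx => k s; rewrite /halted /mstep /= => E.
by rewrite E /= (knext_halt _ E).
Qed.

(** One step initializes the marks; then at most [#|K| * (size w).+1 ^ h.+1] instructions cost at
    most [6 * (size w).+1] steps each. *)
Lemma sim_decides t b :
  halted (iter t mstep (k0, fun=> 0)) b ->
  exists2 q, tm_exec sim_TM ((1 + 6 * #|K|) * (size w).+1 ^ h.+2) (tm_init sim_TM w) = Some q
    & sim_acc q = b.
Proof.
move=> hb; have [//|t' [b' [lt ht nt]]] := halt_bound _ hb.
have tt' : t' <= t by rewrite leqNgt; apply/negP=> /nt; apply; exact: hb.
(* A halted configuration is a fixed point, so the first halt has the same verdict as the given
   one. *)
have eb : b' = b.
  move: hb; rewrite -(subnK tt') iterD (halted_iter _ ht) /halted => e.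
  by move: ht; rewrite /halted e => -[].
have [c1 e1 r1] := init_reaches.
have [n ln [c2 e2 r2]] := @run_reaches t' c1 (k0, fun=> 0) r1 (fun=> leq0n _) nt.
have e := msteps_add n e1; rewrite e2 in e.
case: r2 => eq _ _; exists (cq c2); last first.
  by rewrite eq /sim_acc; move: ht; rewrite /halted -eb => ->; case: b' {nt eb}.
apply: tm_exec_msteps e _ _.
  rewrite /tm_step eq /=; move: ht; rewrite /halted.
  by case: (cc c2) => [[? ?] ?] /= ->.
have : t' * (2 * size w + 6) <= #|K| * (size w).+1 ^ h.+1 * (6 * (size w).+1).
  by apply: leq_mul => //; lia.
have : 0 < (size w).+1 ^ h.+2 by rewrite expn_gt0.
rewrite [_ ^ h.+2]expnSr; nia.
Qed.

End Simulation.

(** * Structured pointer programs *)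

Inductive cmd :=
  CSkip | CAcc | CInc of nat | CZero of nat | CSeq of cmd & cmd
| CIf of test & cmd & cmd | CUntil of test & cmd.

Lemma cmd_comparable : comparable cmd.
Proof. by rewrite /comparable /decidable; do !decide equality. Qed.

HB.instance Definition _ := hasDecEq.Build cmd (compareP cmd_comparable).

(** The control state is the list of commands still to be run: the empty list rejects, a leading
    [CAcc] accepts. *)
Definition cact (k : seq cmd) : act :=
  match k with
  | [::] => AHalt false
  | CAcc :: _ => AHalt true
  | CInc r :: _ => AInc r
  | CZero r :: _ => AZero r
  | CIf t _ _ :: _ | CUntil t _ :: _ => ATest t
  | _ => ANop
  end.

Definition cnext (k : seq cmd) (b : bool) : seq cmd :=
  match k with
  | CSkip :: k' | CInc _ :: k' | CZero _ :: k' => k'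
  | CSeq c d :: k' => c :: d :: k'
  | CIf _ c d :: k' => (if b then c else d) :: k'
  | CUntil _ c :: k' => if b then k' else c :: k
  | _ => k
  end.

(** A finite list containing every continuation met while [c] runs before [k]; it makes the control
    states of the simulated machine finite. A loop body has the loop itself in its continuation. *)
Fixpoint conts c k : seq (seq cmd) :=
  (c :: k) ::
  match c with
  | CSeq c1 c2 => conts c1 (c2 :: k) ++ conts c2 k
  | CIf _ c1 c2 => conts c1 k ++ conts c2 k
  | CUntil _ c1 => conts c1 (c :: k)
  | _ => [::]
  end.

Lemma conts_head c k : c :: k \in conts c k.
Proof. by case: c => *; rewrite inE eqxx. Qed.

Lemma conts_next c k x b : x \in conts c k -> cnext x b \in k :: conts c k.
Proof.
elim: c k x => [||r|r|c IHc d IHd|t c IHc d IHd|t c IHc] k x;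
  rewrite in_cons => /orP[/eqP->|]; rewrite //= ?in_cons ?eqxx ?orbT //.
- by rewrite mem_cat conts_head !orbT.
- rewrite !mem_cat => /orP[/IHc|/IHd]; rewrite in_cons => /orP[/eqP->|->];
    by rewrite ?conts_head ?eqxx ?orbT.
- by rewrite !mem_cat; case: ifP => _; rewrite conts_head !orbT.
- rewrite !mem_cat => /orP[/IHc|/IHd]; rewrite in_cons => /orP[/eqP->|->];
    by rewrite ?conts_head ?eqxx ?orbT.
- by case: ifP => _; rewrite ?conts_head ?eqxx ?orbT.
- by move/IHc; rewrite in_cons => /orP[/eqP->|->]; rewrite ?eqxx ?orbT.
Qed.

Definition cstep w (x : seq cmd * store) : seq cmd * store :=
  let: (b, s') := aeval w x.2 (cact x.1) in (cnext x.1 b, s').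

Lemma cmd_decides (c : cmd) : exists (M : TM) (C d : nat), forall w t b,
  cact (iter t (cstep w) ([:: c], fun=> 0)).1 = AHalt b ->
  exists2 q, tm_exec M (C * (size w).+1 ^ d) (tm_init M w) = Some q & tm_acc M q = b.
Proof.
(* The extra [[::]] is the state reached when the whole program has been run. *)
pose L := [::] :: conts c [::].
pose K : finType := adhoc_seq_sub_finType L.
have k0L : [:: c] \in L by rewrite inE conts_head orbT.
have nextL x b : x \in L -> cnext x b \in L.
  by rewrite inE => /orP[/eqP->|/conts_next]; rewrite ?mem_head.
pose k0 : K := SeqSub k0L.
pose nx (k : K) b : K := SeqSub (nextL _ b (ssvalP k)).
pose ac (k : K) := cact (ssval k).
pose h := \max_(k <- L) aregs (cact k).
have hle (k : K) : aregs (ac k) <= h.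
  by case: k => k kL; rewrite /ac /=; exact: (@leq_bigmax_seq _ L xpredT (fun k => aregs (cact
      k)) k kL isT).
have hlt k b b' : ac k = AHalt b -> nx k b' = k.
  by case: k => k kL e; apply/val_inj; move: e; rewrite /ac /=; case: k {kL} => // -[].
exists (sim_TM k0 nx ac h), (1 + 6 * #|K|), h.+2 => w t b eb.
apply: (@sim_decides K k0 nx ac h w hle hlt t b).
suff -> : halted ac (iter t (mstep nx ac w) (k0, fun=> 0)) b =
          (cact (iter t (cstep w) ([:: c], fun=> 0)).1 = AHalt b) by [].
have e i : (fun x => (ssval x.1, x.2)) (iter i (mstep nx ac w) (k0, fun=> 0)) =
      iter i (cstep w) ([:: c], fun=> 0).
  elim: i => //= i; case: (iter i (mstep nx ac w) (k0, fun=> 0)) => k s /= <-.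
  by rewrite /mstep /cstep /= -/(ac k); case: aeval.
by rewrite -e /halted.
Qed.

(** Quantifying over the continuation [k] is what makes runs compose. *)
Definition exec w c (s s' : store) :=
  forall k, exists t, iter t (cstep w) (c :: k, s) = (k, s').

Lemma exec_inc w r s : s r < size w -> exec w (CInc r) s (upd s r (s r).+1).
Proof. by move=> lt k; exists 1; rewrite /= /cstep /= lt. Qed.

Lemma exec_inc_max w r s : s r = size w -> exec w (CInc r) s s.
Proof. by move=> e k; exists 1; rewrite /= /cstep /= e ltnn. Qed.

Lemma exec_zero w r s : exec w (CZero r) s (upd s r 0).
Proof. by move=> k; exists 1. Qed.

Lemma exec_seq w c d s s' s'' :
  exec w c s s' -> exec w d s' s'' -> exec w (CSeq c d) s s''.
Proof.
move=> Hc Hd k; have [t e] := Hc (d :: k); have [t' e'] := Hd k.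
by exists (t' + t.+1); rewrite iterD iterSr [cstep _ _]/= e.
Qed.

Lemma exec_if w t c d s s' :
  exec w (if teval w s t then c else d) s s' -> exec w (CIf t c d) s s'.
Proof. by move=> H k; have [n e] := H k; exists n.+1; rewrite iterSr. Qed.

(** [I] is invariant and variant in one: its index is the number of rounds still to come. *)
Lemma exec_until w t c (I : nat -> store -> Prop) m s :
    (forall m s, I m.+1 s -> teval w s t = false /\ exists2 s', exec w c s s' & I m s') ->
    (forall s, I 0 s -> teval w s t) -> I m s ->
  exists2 s', exec w (CUntil t c) s s' & I 0 s'.
Proof.
move=> HS H0; elim: m s => [|m IHm] s Is.
  by exists s => // k; exists 1; rewrite /= /cstep /= H0.
have [ts [s1 e1 I1]] := HS _ _ Is; have [s2 e2 I2] := IHm _ I1.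
exists s2 => // k; have [n1 {}e1] := e1 (CUntil t c :: k); have [n2 {}e2] := e2 k.
by exists (n2 + n1.+1); rewrite iterD iterSr /cstep /= ts -/(cstep w) e1.
Qed.

(** * Functions computed by pointer programs *)

Definition post w f regs dst (s s' : store) :=
  [/\ inrange w s', s' dst = f w [seq s r | r <- regs] & forall r, r < dst -> s' r = s r].

(* Registers from [dst] on are scratch space.  Registers never exceed [size w],
   so every function in [calc] is bounded by [size w] on bounded arguments. *)
Definition calc (f : seq bool -> seq nat -> nat) :=
  forall regs dst, all (fun r => r < dst) regs ->
  exists c, forall w s, 0 < size w -> inrange w s ->
  exists2 s', exec w c s s' & post w f regs dst s s'.

Lemma map_agree (regs : seq nat) (s s' : store) dst :
  all (fun r => r < dst) regs -> (forall r, r < dst -> s' r = s r) ->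
  [seq s' r | r <- regs] = [seq s r | r <- regs].
Proof. by move=> /allP H e; apply/eq_in_map=> r /H /e. Qed.

Lemma allS dst dst' (regs : seq nat) : dst <= dst' ->
  all (fun r => r < dst) regs -> all (fun r => r < dst') regs.
Proof. by move=> le; apply: sub_all => r /leq_trans; apply. Qed.

Lemma upd_inrange w s r v : inrange w s -> v <= size w -> inrange w (upd s r v).
Proof. by move=> Hs Hv x; rewrite /upd; case: eqP. Qed.

(** There is no move instruction; [dst] is counted up from 0 until it meets [r]. *)
Lemma exec_copy w s r dst : r != dst -> inrange w s ->
  exists2 s', exec w (CSeq (CZero dst) (CUntil (TEq r dst) (CInc dst))) s s' &
    [/\ inrange w s', s' dst = s r & forall x, x != dst -> s' x = s x].
Proof.
move=> nr Hs.
pose I m (s1 : store) := [/\ inrange w s1, s1 dst + m = s r & forall x, x != dst -> s1 x = s x].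
have [|||s' e' [H1 H2 H3]] := @exec_until w (TEq r dst) (CInc dst) I (s r) (upd s dst 0).
- move=> m s1 [Hs1 e1 E1]; split; first by rewrite /= E1 //; apply/eqP; lia.
  have lt : s1 dst < size w by have := Hs r; lia.
  exists (upd s1 dst (s1 dst).+1); first exact: exec_inc.
  split; first exact: upd_inrange.
    by rewrite /upd eqxx; lia.
  by move=> x nx; rewrite /upd (negbTE nx) E1.
- by move=> s1 [_ e1 E1]; rewrite /= E1 // -e1 addn0.
- split; [exact: upd_inrange | by rewrite /upd eqxx |].
  by move=> x nx; rewrite /upd (negbTE nx).
- exists s'; first exact: exec_seq (exec_zero _ _ _) e'.
  by split=> //; rewrite -H2 addn0.
Qed.

Lemma calc_var i : calc (fun w a => nth 0 a i).
Proof.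
move=> regs dst Hr; have [lt|ge] := ltnP i (size regs).
  have ri : nth 0 regs i < dst by apply: (allP Hr); rewrite mem_nth.
  exists (CSeq (CZero dst) (CUntil (TEq (nth 0 regs i) dst) (CInc dst))) => w s w0 Hs.
  have [|s' e [H1 H2 H3]] := @exec_copy w s (nth 0 regs i) dst _ Hs; first by rewrite ltn_eqF.
  exists s' => //; split=> //; first by rewrite (nth_map 0).
  by move=> r lr; rewrite H3 // ltn_eqF.
exists (CZero dst) => w s w0 Hs; exists (upd s dst 0); first exact: exec_zero.
split; first exact: upd_inrange.
  by rewrite /upd eqxx nth_default ?size_map.
by move=> r lr; rewrite /upd ltn_eqF.
Qed.

(** Arguments behave like de Bruijn variables: this is weakening, and [calc_let] is binding. *)
Lemma calc_behead f : calc f -> calc (fun w a => f w (behead a)).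
Proof.
move=> Hf regs dst Hr; have [|c Hc] := Hf (behead regs) dst.
  by apply/allP=> r /mem_behead /(allP Hr).
by exists c => w s w0 Hs; have [s' e [H1 H2 H3]] := Hc w s w0 Hs; exists s' => //; split;
    rewrite // H2 behead_map.
Qed.

Lemma calc_let g f : calc g -> calc f -> calc (fun w a => f w (g w a :: a)).
Proof.
move=> Hg Hf regs dst Hr; have [c Hc] := Hg regs dst Hr.
have [|d Hd] := Hf (dst :: regs) dst.+1.
  by rewrite /= ltnSn; apply: allS Hr.
exists (CSeq c (CSeq d (CSeq (CZero dst) (CUntil (TEq dst.+1 dst) (CInc dst))))) => w s w0 Hs.
have [s1 e1 [H1 E1 F1]] := Hc w s w0 Hs.
have [s2 e2 [H2 E2 F2]] := Hd w s1 w0 H1.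
have [|s3 e3 [H3 E3 F3]] := @exec_copy w s2 dst.+1 dst _ H2; first by rewrite gtn_eqF.
exists s3; first exact: exec_seq e1 (exec_seq e2 e3).
split=> //; first by rewrite E3 E2 /= E1 (map_agree Hr F1).
by move=> r lr; rewrite F3 ?ltn_eqF // F2 ?F1 // ltnW.
Qed.

Lemma calc_run f w a : calc f -> 0 < size w -> all (leq^~ (size w)) a -> f w a <= size w.
Proof.
move=> Hf w0 Ha; have [|c Hc] := Hf (iota 0 (size a)) (size a).
  by apply/allP=> r; rewrite mem_iota.
have [|s' _ [H E _]] := Hc w (nth 0 a) w0.
  by move=> r; have [lt|ge] := ltnP r (size a);
    [apply: (allP Ha); rewrite mem_nth | rewrite nth_default].
by move: E; rewrite map_nth_iota0 // take_size => <-.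
Qed.

Lemma calc_ext f g : calc f ->
  (forall w a, 0 < size w -> all (leq^~ (size w)) a -> f w a = g w a) -> calc g.
Proof.
move=> Hf E regs dst Hr; have [c Hc] := Hf regs dst Hr.
exists c => w s w0 Hs; have [s' e [H1 H2 H3]] := Hc w s w0 Hs; exists s' => //.
split=> //; rewrite -E //; apply/allP=> _ /mapP[r _ ->]; exact: Hs.
Qed.

Lemma exec_bool w s t dst : 0 < size w ->
  exec w (CIf t (CSeq (CZero dst) (CInc dst)) (CZero dst)) s
    (if teval w s t then upd (upd s dst 0) dst 1 else upd s dst 0).
Proof.
move=> w0; apply: exec_if; case: teval; last exact: exec_zero.
apply: exec_seq (exec_zero _ _ _) _.
have e : upd s dst 0 dst = 0 by rewrite /upd eqxx.
by have := @exec_inc w dst (upd s dst 0); rewrite e; apply.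
Qed.

Lemma post_bool w s s0 dst (b : bool) : 0 < size w -> inrange w s ->
  (forall r, r < dst -> s r = s0 r) ->
  let s' := if b then upd (upd s dst 0) dst 1 else upd s dst 0 in
  [/\ inrange w s', s' dst = b & forall r, r < dst -> s' r = s0 r].
Proof.
move=> w0 Hs E /=; split.
- by case: b; repeat apply: upd_inrange.
- by case: b; rewrite /upd eqxx.
- by move=> r lr; case: b; rewrite /upd ltn_eqF // E.
Qed.

Lemma calc_bit g : calc g -> calc (fun w a => nth false w (g w a)).
Proof.
move=> Hg regs dst Hr; have [c Hc] := Hg regs dst Hr.
exists (CSeq c (CIf (TBit dst) (CSeq (CZero dst) (CInc dst)) (CZero dst))) => w s w0 Hs.
have [s1 e1 [H1 E1 F1]] := Hc w s w0 Hs.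
eexists; first exact: exec_seq e1 (exec_bool _ _ _ w0).
by have := post_bool (nth false w (s1 dst)) w0 H1 F1; rewrite /post /= E1.
Qed.

Lemma calc_eq f g : calc f -> calc g -> calc (fun w a => f w a == g w a).
Proof.
move=> Hf Hg regs dst Hr; have [c Hc] := Hf regs dst Hr.
have [|d Hd] := Hg regs dst.+1; first exact: allS Hr.
exists (CSeq c (CSeq d (CIf (TEq dst dst.+1) (CSeq (CZero dst) (CInc dst)) (CZero dst)))) => w
    s w0 Hs.
have [s1 e1 [H1 E1 F1]] := Hc w s w0 Hs.
have [s2 e2 [H2 E2 F2]] := Hd w s1 w0 H1.
eexists; first exact: exec_seq e1 (exec_seq e2 (exec_bool _ _ _ w0)).
have F r : r < dst -> s2 r = s r by move=> lr; rewrite F2 ?F1 // ltnW.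
have := post_bool (s2 dst == s2 dst.+1) w0 H2 F.
by rewrite /post /= (F2 dst) // E1 E2 (map_agree Hr F1).
Qed.

Lemma calc_size : calc (fun w a => size w).
Proof.
move=> regs dst Hr; exists (CSeq (CZero dst) (CUntil (TEnd dst) (CInc dst))) => w s w0 Hs.
pose I m (s1 : store) := [/\ inrange w s1, s1 dst + m = size w & forall x, x < dst -> s1 x = s x].
have [|||s' e' [H1 H2 H3]] := @exec_until w (TEnd dst) (CInc dst) I (size w) (upd s dst 0).
- move=> m s1 [Hs1 e1 E1]; split; first by apply/eqP; lia.
  have lt : s1 dst < size w by lia.
  exists (upd s1 dst (s1 dst).+1); first exact: exec_inc.
  split; first exact: upd_inrange.
    by rewrite /upd eqxx; lia.
  by move=> x nx; rewrite /upd ltn_eqF // E1.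
- by move=> s1 [_ e1 E1]; rewrite /= -e1 addn0.
- split; [exact: upd_inrange | by rewrite /upd eqxx |].
  by move=> x nx; rewrite /upd ltn_eqF.
- exists s'; first exact: exec_seq (exec_zero _ _ _) e'.
  by split=> //; rewrite -H2 addn0.
Qed.

Lemma calc_if (b : seq bool -> seq nat -> bool) f g :
  calc (fun w a => b w a) -> calc f -> calc g -> calc (fun w a => if b w a then f w a else g w a).
Proof.
move=> Hb Hf Hg regs dst Hr; have [cb Hcb] := Hb regs dst Hr.
have [cf Hcf] := Hf regs dst Hr; have [cg Hcg] := Hg regs dst Hr.
(* The truth value is compared with a fresh zero, so the two branches appear swapped. *)
exists (CSeq cb (CSeq (CZero dst.+1) (CIf (TEq dst dst.+1) cg cf))) => w s w0 Hs.
have [s1 e1 [H1 E1 F1]] := Hcb w s w0 Hs.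
have H2 : inrange w (upd s1 dst.+1 0) by apply: upd_inrange.
have F2 r : r < dst -> upd s1 dst.+1 0 r = s r.
  by move=> lr; rewrite /upd ltn_eqF ?F1 // ltnS ltnW.
have t2 : teval w (upd s1 dst.+1 0) (TEq dst dst.+1) = ~~ b w (map s regs).
  by rewrite /= /upd eqxx (ltn_eqF (ltnSn dst)) E1; case: (b _ _).
have [s3 e3 [H3 E3 F3]] : exists2 s3, exec w (if ~~ b w (map s regs) then cg else cf) (upd s1
    dst.+1 0) s3
   & post w (if b w (map s regs) then f else g) regs dst (upd s1 dst.+1 0) s3.
  by case: (b _ _) => /=; [apply: Hcf | apply: Hcg].
exists s3.
  apply: exec_seq e1 (exec_seq (exec_zero _ _ _) _).
  by apply: exec_if; rewrite t2.
split=> // [|r lr]; last by rewrite F3 // F2.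
by rewrite E3 (map_agree Hr F2); case: ifP.
Qed.

(** The successor inherits the saturation of [AInc]; each use has to show that the cap is not
    reached or does no harm. *)
Lemma calc_succ g : calc g -> calc (fun w a => minn (size w) (g w a).+1).
Proof.
move=> Hg regs dst Hr; have [c Hc] := Hg regs dst Hr.
exists (CSeq c (CInc dst)) => w s w0 Hs.
have [s1 e1 [H1 E1 F1]] := Hc w s w0 Hs.
have := H1 dst; rewrite leq_eqVlt => /orP[/eqP e|lt].
  exists s1; first exact: exec_seq e1 (exec_inc_max e).
  by split=> //; rewrite -E1 e; apply/esym/minn_idPl.
exists (upd s1 dst (s1 dst).+1); first exact: exec_seq e1 (exec_inc lt).
split; first exact: upd_inrange.
  by rewrite /upd eqxx -E1; apply/esym/minn_idPr.
by move=> r lr; rewrite /upd ltn_eqF // F1.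
Qed.

(** The source of quantifiers, search, counting and iteration. Register [dst] is the accumulator,
    [dst.+1] the index and [dst.+2] the bound; the body works from [dst.+3] on. *)
Lemma calc_fold b x0 f : calc b -> calc x0 -> calc f ->
  calc (fun w a => foldl (fun acc i => f w (acc :: i :: a)) (x0 w a) (iota 0 (b w a))).
Proof.
move=> Hb Hx Hf regs dst Hr.
have [cx Hcx] := Hx regs dst Hr.
have [|cb Hcb] := Hb regs dst.+2; first by apply: allS Hr; lia.
have [|cf Hcf] := Hf (dst :: dst.+1 :: regs) dst.+3.
  by rewrite /= !ltnS leqnSn leqW //=; apply: allS Hr; lia.
pose body := CSeq cf (CSeq (CSeq (CZero dst) (CUntil (TEq dst.+3 dst) (CInc dst))) (CInc dst.+1)).
exists (CSeq cx (CSeq cb (CSeq (CZero dst.+1) (CUntil (TEq dst.+1 dst.+2) body)))) => w s w0 Hs.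
set a := map s regs.
have [s1 e1 [H1 E1 F1]] := Hcx w s w0 Hs.
have [s2 e2 [H2 E2 F2]] := Hcb w s1 w0 H1.
have b2 : s2 dst.+2 = b w a by rewrite E2 (map_agree Hr F1).
pose acc n := foldl (fun acc i => f w (acc :: i :: a)) (x0 w a) (iota 0 n).
pose I m (s3 : store) := [/\ inrange w s3, s3 dst.+2 = b w a, s3 dst.+1 + m = b w a,
   s3 dst = acc (s3 dst.+1) & forall r, r < dst -> s3 r = s r].
have [|||s' e' [H3 b3 i3 a3 F3]] := @exec_until w (TEq dst.+1 dst.+2) body I (b w a) (upd s2
    dst.+1 0).
- move=> m s3 [H3 b3 i3 a3 F3]; split; first by rewrite /= b3; apply/eqP; lia.
  have [s4 e4 [H4 E4 F4]] := Hcf w s3 w0 H3.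
  have [|s5 e5 [H5 E5 F5]] := @exec_copy w s4 dst.+3 dst _ H4; first by apply/eqP; lia.
  have i5 : s5 dst.+1 = s3 dst.+1 by rewrite F5 ?F4 //; apply/eqP; lia.
  have lt : s5 dst.+1 < size w by rewrite i5; have := H3 dst.+2; lia.
  exists (upd s5 dst.+1 (s5 dst.+1).+1); first exact: exec_seq e4 (exec_seq e5 (exec_inc lt)).
  split.
  + exact: upd_inrange.
  + by rewrite /upd gtn_eqF // F5 ?F4 //; apply/eqP; lia.
  + by rewrite /upd eqxx i5; lia.
  + rewrite /upd eqxx ltn_eqF // i5 E5 E4 /= a3 (map_agree Hr F3) -/a.
    by rewrite /acc -[(s3 _).+1]addn1 iotaD foldl_cat.
  + move=> r lr; rewrite /upd ltn_eqF 1?ltnW // F5 ?ltn_eqF // F4 ?F3 //; lia.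
- by move=> s3 [_ b3 i3 _ _]; rewrite /= b3 -i3 addn0.
- split.
  + exact: upd_inrange.
  + by rewrite /upd gtn_eqF.
  + by rewrite /upd eqxx.
  + by rewrite /upd eqxx ltn_eqF // F2 // E1.
  + move=> r lr; rewrite /upd ltn_eqF 1?ltnW // F2 ?F1 //; lia.
- exists s'; first exact: exec_seq e1 (exec_seq e2 (exec_seq (exec_zero _ _ _) e')).
  by split=> //; rewrite a3 -/a -/(acc _); congr acc; rewrite -i3 addn0.
Qed.

Lemma calc_comp1 (F : seq bool -> nat -> nat) g :
  calc (fun w a => F w (nth 0 a 0)) -> calc g -> calc (fun w a => F w (g w a)).
Proof. by move=> HF Hg; exact: (calc_let Hg HF). Qed.

(** The bit just past the end of the input reads as [false]. *)
Lemma calc_zero : calc (fun w a => 0).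
Proof. by apply: calc_ext (calc_bit calc_size) _ => w a _ _; rewrite nth_default. Qed.

Lemma calc_bool (b : bool) : calc (fun w a => b).
Proof.
case: b; last exact: calc_zero.
by apply: calc_ext (calc_eq calc_zero calc_zero) _ => w a _ _; rewrite eqxx.
Qed.

(** * Decidable predicates, search and counting *)

Definition decb (P : seq bool -> seq nat -> bool) := calc (fun w a => P w a).

Lemma decb_if b P Q : decb b -> decb P -> decb Q -> decb (fun w a => if b w a then P w a else Q
    w a).
Proof.
move=> Hb HP HQ; apply: calc_ext (calc_if Hb HP HQ) _ => w a _ _.
by case: ifP.
Qed.

Lemma decb_neg P : decb P -> decb (fun w a => ~~ P w a).
Proof.
move=> HP; apply: calc_ext (decb_if HP (calc_bool false) (calc_bool true)) _ => w a _ _.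
by case: (P w a).
Qed.

Lemma decb_and P Q : decb P -> decb Q -> decb (fun w a => P w a && Q w a).
Proof. by move=> HP HQ; exact: (decb_if HP HQ (calc_bool false)). Qed.

Lemma decb_or P Q : decb P -> decb Q -> decb (fun w a => P w a || Q w a).
Proof. by move=> HP HQ; exact: (decb_if HP (calc_bool true) HQ). Qed.

Lemma decb_eq f g : calc f -> calc g -> decb (fun w a => f w a == g w a).
Proof. exact: calc_eq. Qed.

Lemma decb_eqb P Q : decb P -> decb Q -> decb (fun w a => P w a == Q w a).
Proof.
move=> HP HQ; apply: calc_ext (decb_if HP HQ (decb_neg HQ)) _ => w a _ _.
by case: (P w a); case: (Q w a).
Qed.

Lemma decb_bit f : calc f -> decb (fun w a => nth false w (f w a)).
Proof. exact: calc_bit. Qed.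

Lemma decb_all b P : calc b -> decb P ->
  decb (fun w a => all (fun i => P w (i :: a)) (iota 0 (b w a))).
Proof.
move=> Hb HP.
have H := calc_fold Hb (calc_bool true)
  (decb_if (decb_eq (calc_var 0) calc_zero) (calc_bool false) (calc_behead HP)).
apply: calc_ext H _ => w a _ _.
suff E l (c : bool) : foldl (fun acc i => nat_of_bool (if acc == 0 then false else P w (i ::
    a))) c l
    = c && all (fun i => P w (i :: a)) l by exact: (E _ true).
elim: l c => [|i l IHl] c; first by rewrite andbT.
rewrite [LHS]/= [in RHS]/= andbA -IHl; congr foldl.
by case: c.
Qed.

Lemma decb_has b P : calc b -> decb P ->
  decb (fun w a => has (fun i => P w (i :: a)) (iota 0 (b w a))).
Proof.
move=> Hb HP; apply: calc_ext (decb_neg (decb_all Hb (decb_neg HP))) _ => w a _ _.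
by rewrite -[in RHS](negbK (has _ _)) -all_predC.
Qed.

(** Hides the loop index of [calc_fold] from the body and leaves the accumulator in front. *)
Lemma calc_drop2 f : calc f -> calc (fun w a => f w (take 1 a ++ drop 2 a)).
Proof.
move=> Hf regs dst Hr; have [|c Hc] := Hf (take 1 regs ++ drop 2 regs) dst.
  by apply/allP=> r; rewrite mem_cat => /orP[/mem_take|/mem_drop]; apply: (allP Hr).
exists c => w s w0 Hs; have [s' e [H1 H2 H3]] := Hc w s w0 Hs; exists s' => //.
by split; rewrite // H2 map_cat map_take map_drop.
Qed.

Lemma calc_iter b x0 f : calc b -> calc x0 -> calc f ->
  calc (fun w a => iter (b w a) (fun x => f w (x :: a)) (x0 w a)).
Proof.
move=> Hb Hx Hf; apply: calc_ext (calc_fold Hb Hx (calc_drop2 Hf)) _ => w a _ _.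
elim: (b w a) => // n IHn; rewrite -[n.+1]addn1 iotaD foldl_cat IHn /= drop0.
by rewrite addn1.
Qed.

(** The accumulator equals the index exactly as long as there was no hit; after that it stays frozen
    at the first hit. *)
Lemma calc_find b P : calc b -> decb P ->
  calc (fun w a => find (fun i => P w (i :: a)) (iota 0 (b w a))).
Proof.
move=> Hb HP.
have H := calc_fold Hb calc_zero
  (calc_if (decb_and (decb_eq (calc_var 0) (calc_var 1)) (decb_neg (calc_behead HP)))
     (calc_succ (calc_var 1)) (calc_var 0)).
apply: calc_ext H _ => w a w0 Ha /=.
have := calc_run Hb w0 Ha; elim: (b w a) => // n IHn lt.
rewrite -[n.+1]addn1 iotaD foldl_cat IHn 1?ltnW // find_cat /=.
have [h|h] := boolP (has (fun i => P w (i :: a)) (iota 0 n)).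
  by rewrite ltn_eqF //= -[X in _ < X](size_iota 0 n) -has_find.
rewrite hasNfind // size_iota eqxx /=; case: (P _ _) => /=; rewrite ?addn0 //.
by rewrite addn1; apply/minn_idPr.
Qed.

Lemma calc_count b P : calc b -> decb P ->
  calc (fun w a => count (fun i => P w (i :: a)) (iota 0 (b w a))).
Proof.
move=> Hb HP.
have H := calc_fold Hb calc_zero (calc_if (calc_behead HP) (calc_succ (calc_var 0)) (calc_var 0)).
apply: calc_ext H _ => w a w0 Ha /=.
have := calc_run Hb w0 Ha; elim: (b w a) => // n IHn lt.
rewrite -[n.+1]addn1 iotaD foldl_cat IHn 1?ltnW // count_cat /=.
case: (P _ _); rewrite /= ?addn0 // addn1; apply/minn_idPr.
by apply: leq_trans lt; rewrite ltnS -[X in _ <= X](size_iota 0 n) count_size.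
Qed.

(** * Arithmetic within the range of the pointers *)

Lemma decb_ltn f g : calc f -> calc g -> decb (fun w a => f w a < g w a).
Proof.
move=> Hf Hg; apply: calc_ext (decb_has Hg (decb_eq (calc_var 0) (calc_behead Hf))) _ => w a _
    _ /=.
congr nat_of_bool; apply/hasP/idP => [[i]|lt].
  by rewrite mem_iota add0n /= => lt /eqP <-.
by exists (f w a); rewrite ?mem_iota.
Qed.

Lemma decb_leq f g : calc f -> calc g -> decb (fun w a => f w a <= g w a).
Proof.
by move=> Hf Hg; apply: calc_ext (decb_neg (decb_ltn Hg Hf)) _ => w a _ _; rewrite -leqNgt.
Qed.

Lemma decb_odd f : calc f -> decb (fun w a => odd (f w a)).
Proof.
move=> Hf; apply: calc_ext (calc_iter Hf calc_zero (decb_eq (calc_var 0) calc_zero)) _ => w a _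
    _ /=.
by elim: (f w a) => //= n ->; case: (odd n).
Qed.

(* Halving without leaving the range [0, size w]. *)
Lemma count_odd_iota n : count odd (iota 0 n) = n./2.
Proof.
elim: n => // n IHn; rewrite -[n.+1]addn1 iotaD count_cat IHn /= addn0 add0n.
by rewrite addn1 -uphalfE uphalf_half addnC.
Qed.

Lemma calc_half f : calc f -> calc (fun w a => (f w a)./2).
Proof.
move=> Hf; apply: calc_ext (calc_count Hf (decb_odd (calc_var 0))) _ => w a _ _.
exact: count_odd_iota.
Qed.

Lemma calc_half_iter f g : calc f -> calc g -> calc (fun w a => iter (f w a) half (g w a)).
Proof. by move=> Hf Hg; exact: (calc_iter Hf Hg (calc_half (calc_var 0))). Qed.

(** Saturation is harmless here: at [size w] and beyond, every bit reads as [false]. *)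
Lemma decb_bitS f : calc f -> decb (fun w a => nth false w (f w a).+1).
Proof.
move=> Hf; apply: calc_ext (decb_bit (calc_succ Hf)) _ => w a _ _ /=; congr nat_of_bool.
rewrite /minn; case: ltnP => // le.
by rewrite !nth_default // leqW.
Qed.

(* Tokens are the bit pairs at even positions: [10] opens a node, [11] closes it,
   and [0b] is a leaf. *)
Definition openb w i := [&& ~~ odd i, nth false w i & ~~ nth false w i.+1].
Definition closeb w i := [&& ~~ odd i, nth false w i & nth false w i.+1].

Lemma decb_openb f : calc f -> decb (fun w a => openb w (f w a)).
Proof.
move=> Hf; exact: (decb_and (decb_neg (decb_odd Hf)) (decb_and (decb_bit Hf) (decb_neg
    (decb_bitS Hf)))).
Qed.

Lemma decb_closeb f : calc f -> decb (fun w a => closeb w (f w a)).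
Proof.
move=> Hf; exact: (decb_and (decb_neg (decb_odd Hf)) (decb_and (decb_bit Hf) (decb_bitS Hf))).
Qed.

Definition balanced w p q :=
  count (fun i => (p <= i) && openb w i) (iota 0 q) ==
  count (fun i => (p <= i) && closeb w i) (iota 0 q).

(* The position after the subtree at [p] is the first one after [p] at which as
   many nodes have been closed as opened. *)
Definition skip w p :=
  find (fun q => [&& p < q, ~~ odd q & balanced w p q]) (iota 0 (size w)).

Lemma calc_skip f : calc f -> calc (fun w a => skip w (f w a)).
Proof.
move=> Hf; apply: (calc_comp1 (F := skip)) Hf.
have H3 (P : seq bool -> nat -> bool) : (forall f, calc f -> decb (fun w a => P w (f w a))) ->
    calc (fun w a => count (fun i => (nth 0 a 1 <= i) && P w i) (iota 0 (nth 0 a 0))).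
  move=> HP.
  exact: (calc_count (calc_var 0) (decb_and (decb_leq (calc_var 2) (calc_var 0)) (HP _
      (calc_var 0)))).
exact: (calc_find calc_size (decb_and (decb_ltn (calc_var 1) (calc_var 0))
  (decb_and (decb_neg (decb_odd (calc_var 0))) (decb_eq (H3 _ decb_openb) (H3 _ decb_closeb))))).
Qed.

(** The position [p + 2] just after the opening token, in the saturated form that two uses of
    [calc_succ] produce. *)
Definition first_child (w : seq bool) p := minn (size w) (minn (size w) p.+1).+1.

Definition child w p j := iter j (skip w) (first_child w p).

Lemma calc_child f g : calc f -> calc g -> calc (fun w a => child w (f w a) (g w a)).
Proof.
by move=> Hf Hg; exact: (calc_iter Hg (calc_succ (calc_succ Hf)) (calc_skip (calc_var 0))).
Qed.

(** The child position after the last child is the closing token of the node. *)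
Definition arity w p := find (fun j => closeb w (child w p j)) (iota 0 (size w)).

Lemma calc_arity f : calc f -> calc (fun w a => arity w (f w a)).
Proof.
move=> Hf; exact: (calc_find calc_size (decb_closeb (calc_child (calc_behead Hf) (calc_var 0)))).
Qed.

(* Compares the binary digits at [p] with those of [v] instead of decoding them,
   which would need intermediate values above [size w]. *)
Definition matchn w p v :=
  all (fun j => odd (iter j half v) == nth false w (child w p j).+1) (iota 0 (arity w p))
  && (iter (arity w p) half v == 0).

Lemma decb_matchn f g : calc f -> calc g -> decb (fun w a => matchn w (f w a) (g w a)).
Proof.
move=> Hf Hg; exact: (decb_and (decb_all (calc_arity Hf)
  (decb_eqb (decb_odd (calc_half_iter (calc_var 0) (calc_behead Hg)))
           (decb_bitS (calc_child (calc_behead Hf) (calc_var 0)))))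
  (decb_eq (calc_half_iter (calc_arity Hf) Hg) calc_zero)).
Qed.

(** * Balance of opening and closing tokens in encoded trees *)

Lemma ebits_node ts : ebits (ENode ts) = [:: true; false] ++ flatten (map ebits ts) ++ [::
    true; true].
Proof. by congr (_ ++ _); congr (_ ++ _); elim: ts => //= t ts ->. Qed.

Lemma etree_ind_seq (P : etree -> Prop) : (forall b, P (EBit b)) ->
  (forall ts, foldr (fun t Q => P t /\ Q) True ts -> P (ENode ts)) -> forall t, P t.
Proof.
move=> HB HN; fix IH 1; case=> [b|ts]; first exact: HB.
by apply: HN; elim: ts => //= t ts Hts; split.
Qed.

Lemma ebits_even t : ~~ odd (size (ebits t)).
Proof.
elim/etree_ind_seq: t => // ts; rewrite ebits_node !size_cat !oddD /= addbF.
by elim: ts => //= t ts IH [Ht /IH]; rewrite size_cat oddD; move/negbTE: Ht => ->.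
Qed.

Fixpoint nop (s : seq bool) := if s is a :: b :: s' then (a && ~~ b) + nop s' else 0.
Fixpoint ncl (s : seq bool) := if s is a :: b :: s' then (a && b) + ncl s' else 0.

Lemma seq_ind2_even (P : seq bool -> Prop) : P [::] ->
  (forall a b s, ~~ odd (size s) -> P s -> P (a :: b :: s)) -> forall s, ~~ odd (size s) -> P s.
Proof.
move=> H0 H2 s; have [n] := ubnP (size s); elim: n s => // n IH [|a [|b s]] //= lt.
by rewrite negbK => e; apply: H2 => //; apply: IH => //; lia.
Qed.

Lemma nop_cat s1 s2 : ~~ odd (size s1) -> nop (s1 ++ s2) = nop s1 + nop s2.
Proof. by move: s1; apply: seq_ind2_even => //= a b s _ ->; rewrite addnA. Qed.

Lemma ncl_cat s1 s2 : ~~ odd (size s1) -> ncl (s1 ++ s2) = ncl s1 + ncl s2.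
Proof. by move: s1; apply: seq_ind2_even => //= a b s _ ->; rewrite addnA. Qed.

Lemma count_tokens pre s suf : ~~ odd (size pre) -> ~~ odd (size s) ->
  let w := pre ++ s ++ suf in
  count (openb w) (iota (size pre) (size s)) = nop s /\
  count (closeb w) (iota (size pre) (size s)) = ncl s.
Proof.
move=> Hp Hs; move: s Hs pre Hp; apply: seq_ind2_even => // a b s _ IHs pre Hpre.
have [|] := IHs (pre ++ [:: a; b]); first by rewrite size_cat oddD /= addbF.
rewrite size_cat addn2 -catA /= => -> ->.
have n0 : nth false (pre ++ [:: a, b & s ++ suf]) (size pre) = a by rewrite nth_cat ltnn subnn.
have n1 : nth false (pre ++ [:: a, b & s ++ suf]) (size pre).+1 = b.
  by rewrite nth_cat ltnNge leqnSn subSnn.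
by rewrite /openb /closeb n0 n1 /= Hpre.
Qed.

Lemma balancedE pre s suf : ~~ odd (size pre) -> ~~ odd (size s) ->
  balanced (pre ++ s ++ suf) (size pre) (size pre + size s) = (nop s == ncl s).
Proof.
move=> Hp Hs; rewrite /balanced iotaD !count_cat add0n.
have [<- <-] := count_tokens suf Hp Hs.
have H (P : pred nat) : count (fun i => (size pre <= i) && P i) (iota 0 (size pre)) = 0 /\
     count (fun i => (size pre <= i) && P i) (iota (size pre) (size s)) = count P (iota (size
         pre) (size s)).
  split; last by apply: eq_in_count => i; rewrite mem_iota => /andP[->].
  apply/eqP; rewrite -leqn0 leqNgt -has_count; apply/hasPn => i; rewrite mem_iota add0n /=.
  by rewrite ltnNge => /negbTE->.
by rewrite !(proj1 (H _)) !(proj2 (H _)).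
Qed.

Lemma flatten_even us : ~~ odd (size (flatten (map ebits us))).
Proof.
elim: us => //= u us IH; rewrite size_cat oddD (negbTE (ebits_even _)).
by rewrite (negbTE IH).
Qed.

Lemma ebits_balanced t : nop (ebits t) = ncl (ebits t).
Proof.
elim/etree_ind_seq: t => [[]|ts Hts] //; rewrite ebits_node.
suff e : nop (flatten (map ebits ts)) = ncl (flatten (map ebits ts)).
  by rewrite /= nop_cat ?flatten_even // ncl_cat ?flatten_even //= e; lia.
elim: ts Hts => //= t ts IH [Ht /IH e].
by rewrite nop_cat ?ncl_cat ?ebits_even // Ht e.
Qed.

Lemma size_take_even T (s : seq T) r : ~~ odd (size s) -> ~~ odd r -> ~~ odd (size (take r s)).
Proof. by rewrite size_take => H1 H2; case: ifP. Qed.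

(** The root stays open until the last token, and a prefix of the children never closes more nodes
    than it opens. This is why [skip] does not stop early. *)
Lemma ebits_unbalanced t q : ~~ odd q -> 0 < q < size (ebits t) ->
  ncl (take q (ebits t)) < nop (take q (ebits t)).
Proof.
elim/etree_ind_seq: t q => [b|ts Hts] q; first by case: q => [|[|q]].
rewrite ebits_node.
case: q => [|[|q]] //=; rewrite negbK => ev; rewrite size_cat /= addn2 !ltnS => lt.
have {}lt : q <= size (flatten (map ebits ts)).
  by rewrite leqNgt; apply/negP => lt'; have := flatten_even ts; lia.
rewrite takel_cat //; suff : ncl (take q (flatten (map ebits ts))) <= nop (take q (flatten (map
    ebits ts))) by lia.
elim: ts Hts q ev lt => [|t ts IH] //= [Ht Hts] q ev lt.
rewrite take_cat; case: ltnP => [lt'|ge].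
  case: q ev lt lt' => [|q] ev lt lt'; first by rewrite take0.
  by apply/ltnW/Ht.
rewrite nop_cat ?ncl_cat ?ebits_even // ebits_balanced leq_add2l.
apply: IH => //; first by rewrite oddB // (negbTE (ebits_even _)) addbF.
by move: lt; rewrite size_cat; lia.
Qed.

(** Parity belongs to the invariant because tokens are recognized only at even positions. *)
Definition tree_at w p t :=
  exists pre suf, [/\ w = pre ++ ebits t ++ suf, size pre = p & ~~ odd p].

Lemma skip_at w p t : tree_at w p t -> skip w p = p + size (ebits t).
Proof.
case=> pre [suf [wE <- Hp]].
have bal q : ~~ odd q -> 0 < q <= size (ebits t) ->
    balanced w (size pre) (size pre + q) = (q == size (ebits t)).
  move=> eq /andP[q0 qs]; rewrite -{1}(size_takel qs).
  rewrite [w](_ : _ = pre ++ take q (ebits t) ++ (drop q (ebits t) ++ suf)); last first.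
    by rewrite wE -{1}(cat_take_drop q (ebits t)) -!catA.
  rewrite balancedE ?size_take_even ?ebits_even //.
  case: (q =P size (ebits t)) => [->|/eqP ne]; first by rewrite take_size ebits_balanced eqxx.
  by rewrite gtn_eqF // ebits_unbalanced // q0 ltn_neqAle ne.
have s0 : 0 < size (ebits t) by case: (t).
pose P q := [&& size pre < q, ~~ odd q & balanced w (size pre) q]; rewrite /skip -/P.
have sw : size w = size pre + size (ebits t) + size suf by rewrite wE !size_cat addnA.
have Pend : P (size pre + size (ebits t)).
  rewrite /P oddD (negbTE Hp) ebits_even bal ?ebits_even ?s0 ?leqnn // eqxx andbT.
  by rewrite -[X in X < _]addn0 ltn_add2l s0.
have nP q : q < size pre + size (ebits t) -> ~~ P q.
  move=> lt; apply/negP => /and3P[lt' ev]; have -> : q = size pre + (q - size pre) by lia.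
  rewrite bal; [lia| by rewrite oddB 1?ltnW // (negbTE Hp) addbF|lia].
rewrite sw iotaD find_cat size_iota hasNfind ?size_iota; last first.
  by apply/hasPn => i; rewrite mem_iota => /nP.
case: hasP => [[i]|_]; first by rewrite mem_iota => /nP/negP.
(* If [suf] is empty, the end of the tree is not among the searched positions; the failing [find]
   then returns [size w], which is that end. *)
by case: (size suf) => [|n] /=; rewrite ?add0n ?Pend addn0.
Qed.

(** * Navigating the encoding *)

Definition leaf := EBit false.

Definition offset p ts j := p + 2 + size (flatten (map ebits (take j ts))).

Lemma tree_at_nth w p ts j : tree_at w p (ENode ts) -> j < size ts ->
  tree_at w (offset p ts j) (nth leaf ts j).
Proof.
case=> pre [suf [-> <- Hp]] lt; rewrite ebits_node.
exists (pre ++ [:: true; false] ++ flatten (map ebits (take j ts))).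
exists (flatten (map ebits (drop j.+1 ts)) ++ [:: true; true] ++ suf); split.
- by rewrite -{1}(cat_take_drop j ts) (drop_nth leaf) // map_cat flatten_cat /= -!catA.
- by rewrite !size_cat /= addnA.
- by rewrite /offset !oddD (negbTE Hp) (negbTE (flatten_even _)).
Qed.

Lemma child_at w p ts j : tree_at w p (ENode ts) -> j <= size ts ->
  child w p j = offset p ts j.
Proof.
move=> H; elim: j => [_|j IHj lt].
  case: H => pre [suf [-> <- Hp]]; rewrite /child /first_child /offset take0 ebits_node.
  by rewrite !size_cat /=; lia.
rewrite /child iterS -/(child w p j) IHj 1?ltnW // (skip_at (tree_at_nth H lt)).
by rewrite /offset -addnA (take_nth leaf) // map_rcons -cats1 flatten_cat size_cat /= cats0.
Qed.

Lemma tree_at_child w p ts j : tree_at w p (ENode ts) -> j < size ts ->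
  tree_at w (child w p j) (nth leaf ts j).
Proof. by move=> H lt; rewrite (child_at H) 1?ltnW //; apply: tree_at_nth. Qed.

Lemma tree_at_start w p t : tree_at w p t -> ~~ closeb w p.
Proof.
case=> pre [suf [-> <- Hp]]; rewrite /closeb !nth_cat ltnn subnn [_.+1 < _]ltnNge leqnSn subSnn.
by case: t => [b|ts] /=; rewrite ?andbF.
Qed.

(** Guarantees that the search in [arity] gets as far as the closing token. *)
Lemma size_tree_at w p ts : tree_at w p (ENode ts) -> size ts < size w.
Proof.
case=> pre [suf [-> _ _]]; rewrite ebits_node !size_cat /=.
suff : size ts <= size (flatten (map ebits ts)) by lia.
elim: ts => //= t ts IH; rewrite size_cat -add1n leq_add //.
by case: (t).
Qed.

Lemma arity_at w p ts : tree_at w p (ENode ts) -> arity w p = size ts.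
Proof.
move=> H.
have lt := size_tree_at H.
have ce : closeb w (child w p (size ts)).
  rewrite (child_at H) // /offset take_size; case: H => pre [suf [-> <- Hp]].
  rewrite ebits_node -!catA; set F := flatten _.
  have -> : pre ++ [:: true; false] ++ F ++ [:: true; true] ++ suf =
      (pre ++ [:: true; false] ++ F) ++ [:: true; true] ++ suf by rewrite -!catA.
  have -> : size pre + 2 + size F = size (pre ++ [:: true; false] ++ F) by rewrite !size_cat
      addnA.
  rewrite /closeb !nth_cat ltnn subnn [_.+1 < _]ltnNge leqnSn subSnn /= andbT.
  by rewrite size_cat oddD (negbTE Hp) /= negbK (negbTE (flatten_even _)).
rewrite /arity -(subnKC (ltnW lt)) iotaD find_cat size_iota hasNfind ?size_iota; last first.
  by apply/hasPn => i; rewrite mem_iota add0n => /(tree_at_child H)/tree_at_start.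
case: hasP => [[i]|_]; first by rewrite mem_iota add0n => /(tree_at_child H)/tree_at_start/negP.
case E : (size w - size ts) => [|m]; first by lia.
by rewrite /= ce addn0.
Qed.

Lemma at_bit w p b : tree_at w p (EBit b) -> nth false w p.+1 = b.
Proof.
by case=> pre [suf [-> <- _]]; rewrite nth_cat ltnNge leqnSn subSnn.
Qed.

Lemma at_bools w p s j : tree_at w p (enc_bools s) -> j < size s ->
  nth false w (child w p j).+1 = nth false s j.
Proof.
move=> H lt; apply: at_bit; rewrite -(nth_map _ leaf) //.
by apply: tree_at_child H _; rewrite size_map.
Qed.

(** Halving [v] once per digit of [x] must produce these digits and leave nothing over. *)
Lemma bits_match fuel x v : x <= fuel ->
  all (fun j => odd (iter j half v) == nth false (bin_aux fuel x) j) (iota 0 (size (bin_aux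
      fuel x)))
    && (iter (size (bin_aux fuel x)) half v == 0) = (x == v).
Proof.
elim: fuel x v => [|f IHf] [|x] v //= le; try by rewrite eq_sym.
rewrite (iotaDl 1) all_map -iterS iterSr -andbA.
rewrite -[X in _ && X](_ : (x.+1)./2 == v./2 = _); last first.
  rewrite -IHf; last by lia.
  congr (_ && _); apply: eq_all => j /=.
  by rewrite -iterS iterSr.
apply/andP/eqP => [[/eqP e1 /eqP e2]|<-]; last by [].
by rewrite -(odd_double_half x.+1) -(odd_double_half v) e2 /= -e1.
Qed.

Lemma matchn_at w p x v : tree_at w p (enc_nat x) -> matchn w p v = (x == v).
Proof.
move=> H; rewrite /matchn (arity_at H) size_map -(bits_match v (leqnn x)).
congr (_ && _); apply: eq_in_all => j; rewrite mem_iota add0n /= => lt.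
by rewrite (@at_bools _ _ _ _ H).
Qed.

(** The encoding lists each edge once, smaller endpoint first, so both orders are tried. *)
Definition adjw w p i v u :=
  has (fun e => let q := child w (child w (child w p 2) i) e in
     (matchn w (child w q 0) u && matchn w (child w q 1) v)
     || (matchn w (child w q 0) v && matchn w (child w q 1) u))
   (iota 0 (arity w (child w (child w p 2) i))).

(* Layers [i] beyond the actual number of layers have empty neighborhoods, and
   [localw] is [false] there: they do not contribute to the master index. *)
Definition nbw w p i v u :=
  (i < arity w (child w p 3)) && ((u == v) || adjw w p i v u).

Definition localw w p i v m :=
  (i < arity w (child w p 3)) &&
  nth false w (child w (child w (child w (child w p 3) i) v) m).+1.

Definition masterw w p v m := nth false w (child w (child w (child w p 4) v) m).+1.

Section Access.
Variables (w : seq bool) (p n : nat) (S : msyds n).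
Hypotheses (wfS : wf_msyds S) (atS : tree_at w p (enc_msyds S)).

Lemma arity_layers : arity w (child w p 3) = nlayers S.
Proof. by rewrite (arity_at (tree_at_child atS (isT : 3 < 5))) size_map size_enum_ord. Qed.

Lemma arity_nodes : arity w (child w p 4) = n.
Proof. by rewrite (arity_at (tree_at_child atS (isT : 4 < 5))) size_map size_enum_ord. Qed.

Lemma adjw_at (i : 'I_(nlayers S)) (v u : 'I_n) : adjw w p i v u = layer S i v u.
Proof.
case: wfS => _ /(_ i)[sym irr] _ _.
pose prs := [seq (x, y) | x : 'I_n <- enum 'I_n,
   y : 'I_n <- [seq y : 'I_n <- enum 'I_n | (x < y) && layer S i x y]].
pose es := [seq ENode [:: enc_nat xy.1; enc_nat xy.2] | xy : 'I_n * 'I_n <- prs].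
have H : tree_at w (child w (child w p 2) i) (ENode es).
  have lt : i < size (enum 'I_(nlayers S)) by rewrite size_enum_ord.
  have := tree_at_child (tree_at_child atS (isT : 2 < 5)) (_ : i < size _).
  rewrite size_map (nth_map i) // nth_ord_enum => /(_ lt).
  by rewrite /es /prs map_allpairs.
have memp x y : ((x, y) \in prs) = (x < y) && layer S i x y.
  apply/allpairsPdep/idP => [[x' [y' [_]]]|xy].
    by rewrite mem_filter => /andP[? _] [-> ->].
  by exists x, y; split=> //; [rewrite mem_enum | rewrite mem_filter mem_enum andbT].
have -> : adjw w p i v u = ((u, v) \in prs) || ((v, u) \in prs).
  rewrite /adjw (arity_at H) size_map.
  have E e : e < size prs -> let q := child w (child w (child w p 2) i) e in
     (matchn w (child w q 0) u && matchn w (child w q 1) v)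
     || (matchn w (child w q 0) v && matchn w (child w q 1) u) =
     ((nth (u, v) prs e == (u, v)) || (nth (u, v) prs e == (v, u))).
    move=> lt q; have := tree_at_child H (_ : e < size es).
    rewrite size_map (nth_map (u, v)) // => /(_ lt); rewrite -/q.
    case: (nth _ _ _) => x y /= Hq.
    rewrite !(matchn_at _ (tree_at_child Hq (isT : 0 < 2))) !(matchn_at _ (tree_at_child Hq
        (isT : 1 < 2))).
    by [].
  apply/hasP/idP => [[e]|].
    rewrite mem_iota add0n /= => lt; rewrite E // => /orP[]/eqP<-; rewrite mem_nth // ?orbT //.
  move=> H'; have [q qp qe] : exists2 q, q \in prs & (q == (u, v)) || (q == (v, u)).
    by case/orP: H' => h; [exists (u, v) | exists (v, u)]; rewrite ?eqxx ?orbT.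
  exists (index q prs); first by rewrite mem_iota add0n index_mem.
  by rewrite E ?index_mem // nth_index.
rewrite !memp [layer S i u v]sym -andb_orl.
case: ltngtP => // /val_inj ->.
by rewrite irr.
Qed.

Lemma nbw_at (i : 'I_(nlayers S)) (v u : 'I_n) : nbw w p i v u = (u \in cnbhd i v).
Proof. by rewrite /nbw arity_layers ltn_ord inE adjw_at. Qed.

Lemma localw_at (i : 'I_(nlayers S)) (v : 'I_n) m :
  m <= #|cnbhd i v| -> localw w p i v m = nth false (symtab S i v) m.
Proof.
case: wfS => _ _ /(_ i v) szt _ le; rewrite /localw arity_layers ltn_ord /=.
apply: at_bools; last by rewrite szt.
have := tree_at_child (tree_at_child atS (isT : 3 < 5)) (_ : i < size _).
rewrite size_map size_enum_ord (nth_map i) ?size_enum_ord // nth_ord_enum => /(_ (ltn_ord i)).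
move=> H; have := tree_at_child H (_ : v < size _).
by rewrite size_map size_enum_ord (nth_map v) ?size_enum_ord // nth_ord_enum => /(_ (ltn_ord v)).
Qed.

Lemma localw_out i v m : nlayers S <= i -> localw w p i v m = false.
Proof. by rewrite /localw arity_layers ltnNge => ->. Qed.

Lemma masterw_at (v : 'I_n) m : m < 2 ^ nlayers S -> masterw w p v m = nth false (mastertab S
    v) m.
Proof.
case: wfS => _ _ _ /(_ v) szt lt; apply: at_bools; last by rewrite szt.
have := tree_at_child (tree_at_child atS (isT : 4 < 5)) (_ : v < size _).
by rewrite size_map size_enum_ord (nth_map v) ?size_enum_ord // nth_ord_enum => /(_ (ltn_ord v)).
Qed.

End Access.

(** * The decision procedure *)

Lemma calc_min i : calc (fun w a => minn (size w) i).
Proof.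
elim: i => [|i IHi]; first by apply: calc_ext calc_zero _ => w a _ _; rewrite minn0.
by apply: calc_ext (calc_succ IHi) _ => w a _ _; lia.
Qed.

(** The constant is only available truncated to [size w], which does not affect a comparison with a
    value at most [size w]. *)
Lemma decb_ltc i f : calc f -> decb (fun w a => i < f w a).
Proof.
move=> Hf; apply: calc_ext (decb_ltn (calc_min i) Hf) _ => w a w0 Ha /=.
by have le := calc_run Hf w0 Ha; congr nat_of_bool; lia.
Qed.

Lemma calc_iter_skip m f : calc f -> calc (fun w a => iter m (skip w) (f w a)).
Proof. by move=> Hf; elim: m => // m IHm; exact: calc_skip IHm. Qed.

Lemma calc_childc f i : calc f -> calc (fun w a => child w (f w a) i).
Proof. by move=> Hf; exact: (calc_iter_skip i (calc_succ (calc_succ Hf))). Qed.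

(** The index is never computed: bit [i] contributes [2 ^ i] skips, a number fixed when the program
    is built. *)
Lemma calc_child_sum f K (b : nat -> seq bool -> seq nat -> bool) : calc f -> (forall i, decb
    (b i)) ->
  calc (fun w a => child w (f w a) (\sum_(i < K) b i w a * 2 ^ i)).
Proof.
move=> Hf Hb; elim: K => [|K IHK].
  by apply: calc_ext (calc_childc 0 Hf) _ => w a _ _; rewrite big_ord0.
apply: calc_ext (calc_if (Hb K) (calc_iter_skip (2 ^ K) IHK) IHK) _ => w a _ _.
rewrite big_ord_recr /= addnC /child iterD; case: (b K w a); by rewrite ?mul1n.
Qed.

Lemma decb_adjw p v u i : calc p -> calc v -> calc u ->
  decb (fun w a => adjw w (p w a) i (v w a) (u w a)).
Proof.
move=> Hp Hv Hu; have HE := calc_childc i (calc_childc 2 Hp).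
have Hq := calc_child (calc_behead HE) (calc_var 0).
exact: (decb_has (calc_arity HE) (decb_or
  (decb_and (decb_matchn (calc_childc 0 Hq) (calc_behead Hu)) (decb_matchn (calc_childc 1 Hq)
      (calc_behead Hv)))
  (decb_and (decb_matchn (calc_childc 0 Hq) (calc_behead Hv)) (decb_matchn (calc_childc 1 Hq)
      (calc_behead Hu))))).
Qed.

Lemma decb_nbw p v u i : calc p -> calc v -> calc u ->
  decb (fun w a => nbw w (p w a) i (v w a) (u w a)).
Proof.
move=> Hp Hv Hu; exact: (decb_and (decb_ltc i (calc_arity (calc_childc 3 Hp)))
  (decb_or (decb_eq Hu Hv) (decb_adjw i Hp Hv Hu))).
Qed.

Lemma decb_localw p v m i : calc p -> calc v -> calc m ->
  decb (fun w a => localw w (p w a) i (v w a) (m w a)).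
Proof.
move=> Hp Hv Hm; exact: (decb_and (decb_ltc i (calc_arity (calc_childc 3 Hp)))
  (decb_bitS (calc_child (calc_child (calc_childc i (calc_childc 3 Hp)) Hv) Hm))).
Qed.

(** Entries run up to [size w] instead of the number of nodes; the larger ones are harmless, as
    every vector describes a configuration. *)
Fixpoint allvec L (w : seq bool) (P : seq nat -> bool) a :=
  if L is L'.+1 then all (fun x => allvec L' w P (x :: a)) (iota 0 (size w)) else P a.

Lemma decb_allvec L P : decb P -> decb (fun w a => allvec L w (P w) a).
Proof. by move=> HP; elim: L => // L IHL; exact: (decb_all calc_size IHL). Qed.

Lemma allvecP L w (P : pred (seq nat)) a :
  reflect (forall t, size t = L -> all (fun x => x < size w) t -> P (t ++ a)) (allvec L w P a).
Proof.
elim: L a => [|L IHL] a /=.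
  by apply: (iffP idP) => [Pa t /size0nil-> //|H]; apply: (H [::]).
apply: (iffP allP) => [H t|H x].
  (* The outermost loop variable ends up last, next to [a], so the vector is split from the
     right. *)
  case/lastP: t => // t x; rewrite size_rcons => -[szt]; rewrite all_rcons cat_rcons.
  by case/andP=> lx /(IHL _ _); apply=> //; apply: H; rewrite mem_iota.
rewrite mem_iota add0n /= => lx; apply/IHL => t szt allt; rewrite -cat_rcons; apply: H.
  by rewrite size_rcons szt.
by rewrite all_rcons lx.
Qed.

Definition push_bit c (b : bool) := c.*2 + b.

Lemma push_bit_inj s s' c c' : size s = size s' ->
  foldl push_bit c s = foldl push_bit c' s' -> c = c' /\ s = s'.
Proof.
elim: s s' c c' => [|b s IHs] [|b' s'] //= c c' [/IHs H /H[]] + ->.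
by rewrite /push_bit; case: b; case: b' => e; split=> //; lia.
Qed.

Lemma push_bit_lt s c : foldl push_bit c s < c.+1 * 2 ^ size s.
Proof.
elim: s c => [|b s IHs] c /=; first by rewrite muln1.
apply: leq_trans (IHs _) _; rewrite expnS mulnA leq_mul2r; apply/orP; right.
by rewrite /push_bit; case: b; lia.
Qed.

(** A decision tree on the bits: at each leaf the index is a constant, so the leaf is a plain
    variable. The successor skips the innermost loop variable, which stands before the
    thresholds. *)
Lemma calc_select (I : Type) (P : I -> seq bool -> seq nat -> bool) l c :
  (forall i, decb (P i)) ->
  calc (fun w a => nth 0 a (foldl push_bit c [seq P i w a | i <- l]).+1).
Proof.
move=> HP; elim: l c => [|i l IHl] c; first exact: (calc_var c.+1).
apply: calc_ext (calc_if (HP i) (IHl (push_bit c true)) (IHl (push_bit c false))) _ => w a _ _ /=.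
by case: (P i w a).
Qed.

Section Formula.
Variable K : nat.

(** The pair [(b, i)] stands for layer [i] of system [b]. The [2 * K] membership bits of a node form
    the number of its class. *)
Definition slots := [seq (b, i) | b <- [:: 0; 1], i <- iota 0 K].

Definition ncells := 2 ^ size slots.

(* In [countw] and [valw] the argument list [a] consists of one threshold per
   class, followed by the node [v]. *)
Definition cellw w v u :=
  foldl push_bit 0 [seq nbw w (child w 0 x.1) x.2 v u | x <- slots].

Definition countw w b i (a : seq nat) :=
  count (fun u => nbw w (child w 0 b) i (nth 0 a ncells) u &&
                  (u < nth 0 a (cellw w (nth 0 a ncells) u)))
        (iota 0 (arity w (child w (child w 0 0) 4))).

Definition valw w b a :=
  masterw w (child w 0 b) (nth 0 a ncells)
    (\sum_(i < K) localw w (child w 0 b) i (nth 0 a ncells) (countw w b i a) * 2 ^ i).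

Definition equivw w (a : seq nat) :=
  all (fun v => allvec ncells w (fun a => valw w 0 a == valw w 1 a) (v :: a))
      (iota 0 (arity w (child w (child w 0 0) 4))).

Lemma decb_valw b : decb (fun w a => valw w b a).
Proof.
have Hp b' : calc (fun w a => child w 0 b') by exact: calc_childc calc_zero.
have Hv := calc_var ncells.
(* Inside the count, [u] is argument 0, so the thresholds and [v] are shifted by one. *)
have Hsel : calc (fun w a => nth 0 a (cellw w (nth 0 a ncells.+1) (nth 0 a 0)).+1).
  apply: (@calc_select _ (fun x w a => nbw w (child w 0 x.1) x.2 (nth 0 a ncells.+1) (nth 0 a
      0)) slots 0).
  by move=> x; exact: (decb_nbw x.2 (Hp x.1) (calc_var ncells.+1) (calc_var 0)).
have Hc i : calc (fun w a => countw w b i a).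
  apply: calc_ext (calc_count (calc_arity (calc_childc 4 (Hp 0)))
    (decb_and (decb_nbw i (Hp b) (calc_var ncells.+1) (calc_var 0)) (decb_ltn (calc_var 0)
        Hsel))) _.
  by [].
apply: decb_bitS; apply: (@calc_child_sum (fun w a => child w (child w (child w 0 b) 4) (nth 0
    a ncells)) K
   (fun i w a => localw w (child w 0 b) i (nth 0 a ncells) (countw w b i a))).
  exact: (calc_child (calc_childc 4 (Hp b)) Hv).
by move=> i; exact: (decb_localw i (Hp b) Hv (Hc i)).
Qed.

Lemma decb_equivw : decb equivw.
Proof.
exact: (decb_all (calc_arity (calc_childc 4 (calc_childc 0 calc_zero)))
  (decb_allvec ncells (decb_eqb (decb_valw 0) (decb_valw 1)))).
Qed.

End Formula.

Lemma decb_decides P : decb P -> exists (M : TM) (c d : nat), forall w, 0 < size w ->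
  exists2 q, tm_exec M (c * (size w).+1 ^ d) (tm_init M w) = Some q & tm_acc M q = P w [::].
Proof.
move=> HP; have [//|c Hc] := HP [::] 0.
pose tail := CSeq (CZero 1) (CIf (TEq 0 1) CSkip CAcc).
have [M [C [d H]]] := cmd_decides (CSeq c tail).
exists M, C, d => w w0; have [|s' e [_ E _]] := Hc w (fun=> 0) w0; first by [].
have [t {}e] := e [:: tail].
have tE : (upd s' 1 0 0 == upd s' 1 0 1) = ~~ P w [::].
  by rewrite /upd /= E; case: (P w _).
(* One step unfolds the outer sequence, [t] steps run [c], and four steps run [tail]. *)
apply: (H w (4 + (t + 1))); rewrite iterD (iterD t) [iter 1 _ _]/= {1}/cstep /= e /cstep /=.
by rewrite !tE; case: (P w [::]).
Qed.

(** * Correctness *)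

(** Discrete intermediate values. Raising a threshold by one admits at most one more node of the
    class, so every count is hit by some threshold. *)
Lemma nat_ivt g n y : g 0 = 0 -> (forall m, g m.+1 <= (g m).+1) -> y <= g n ->
  exists2 m, m <= n & g m = y.
Proof.
move=> g0 gS; elim: n => [|n IHn] le; first by exists 0 => //; lia.
have [/IHn[m lm e]|lt] := leqP y (g n); first by exists m; rewrite // leqW.
by exists n.+1 => //; have := gS n; lia.
Qed.

Lemma count_iota_ord n (P : pred nat) (Q : pred 'I_n) : (forall u : 'I_n, P u = Q u) ->
  count P (iota 0 n) = #|[set u | Q u]|.
Proof.
move=> e; rewrite -val_enum_ord count_map cardsE -sum1_card -sum1_count big_enum_cond /=.
by apply: eq_bigl => u; rewrite /= e.
Qed.

Lemma sum_bits_lt k (b : nat -> bool) : \sum_(i < k) b i * 2 ^ i < 2 ^ k.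
Proof.
elim: k => [|k IHk]; first by rewrite big_ord0.
rewrite big_ord_recr /= expnS; move: (\sum_(_ < _) _) (2 ^ k) IHk => s x.
by case: (b k); lia.
Qed.

Section Correctness.
Variables (K n : nat) (S0 S1 : msyds n).
Hypotheses (wf0 : wf_msyds S0) (wf1 : wf_msyds S1).
Hypotheses (K0 : nlayers S0 <= K) (K1 : nlayers S1 <= K).

Let sys b := if b is 0 then S0 else S1.
Let w := enc_instance S0 S1.

Let wf_sys b : wf_msyds (sys b). Proof. by case: b. Qed.
Let sysK b : nlayers (sys b) <= K. Proof. by case: b. Qed.

Lemma at_sys b : b < 2 -> tree_at w (child w 0 b) (enc_msyds (sys b)).
Proof.
move=> b2; have H : tree_at w 0 (ENode [:: enc_msyds S0; enc_msyds S1]).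
  by exists [::], [::]; rewrite cats0.
by case: b b2 => [|[|b]] // b2; exact: (tree_at_child H b2).
Qed.

Lemma arity_nodes_sys : arity w (child w (child w 0 0) 4) = n.
Proof. exact: (arity_nodes (at_sys (isT : 0 < 2))). Qed.

Definition cell_of (v u : 'I_n) := cellw K w v u.

Lemma cell_lt v u : cell_of v u < ncells K.
Proof. by have := push_bit_lt [seq nbw w (child w 0 x.1) x.2 v u | x <- slots K] 0; rewrite
    mul1n size_map. Qed.

Lemma cell_nbhd b (i : 'I_(nlayers (sys b))) v u u' : b < 2 ->
  cell_of v u = cell_of v u' -> (u \in cnbhd i v) = (u' \in cnbhd i v).
Proof.
move=> b2 /push_bit_inj[|_ /eq_in_map e]; first by rewrite !size_map.
rewrite -!(nbw_at (wf_sys b) (at_sys b2)); apply: (e (b, val i)).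
apply/allpairsP; exists (b, val i); split=> //=; first by rewrite !inE; case: (b) b2 => [|[]].
by rewrite mem_iota add0n /= (leq_trans (ltn_ord i)).
Qed.

Definition threshold_config (t : seq nat) (v : 'I_n) : config n :=
  [ffun u : 'I_n => u < nth 0 t (cell_of v u)].

Lemma valw_at b t (v : 'I_n) : b < 2 -> size t = ncells K ->
  valw K w b (t ++ [:: val v]) = succ (sys b) (threshold_config t v) v.
Proof.
move=> b2 szt; set C := threshold_config t v.
have nv : nth 0 (t ++ [:: val v]) (ncells K) = v by rewrite nth_cat szt ltnn subnn.
have cnt (i : 'I_(nlayers (sys b))) : countw K w b i (t ++ [:: val v]) = #|[set u in cnbhd i v
    | C u]|.
  rewrite /countw nv arity_nodes_sys.
  apply: (count_iota_ord (Q := fun u => (u \in cnbhd i v) && C u)) => u.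
  rewrite -(nbw_at (wf_sys b) (at_sys b2)) nth_cat szt -/(cell_of v u) cell_lt.
  by rewrite ffunE.
pose F i := localw w (child w 0 b) i v (countw K w b i (t ++ [:: val v])) : nat.
have FE (i : 'I_(nlayers (sys b))) : F i = local_val i v C.
  rewrite /F cnt (localw_at (wf_sys b) (at_sys b2)) //.
  by apply/subset_leq_card/subsetP => u; rewrite inE => /andP[].
have sumE : \sum_(i < K) F i * 2 ^ i = \sum_(i < nlayers (sys b)) local_val i v C * 2 ^ i.
  transitivity (\sum_(i < nlayers (sys b)) F i * 2 ^ i); last by apply: eq_bigr => i _; rewrite
      FE.
  rewrite (big_ord_widen K (fun i => F i * 2 ^ i) (sysK b)) [RHS]big_mkcond /=.
  apply: eq_bigr => i _; case: ltnP => // ge.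
  by rewrite /F (localw_out (at_sys b2)).
rewrite /valw nv sumE ffunE; apply: masterw_at => //; first exact: at_sys.
under eq_bigr => i _ do rewrite -FE.
exact: (sum_bits_lt _ (fun i => localw w (child w 0 b) i v (countw K w b i (t ++ [:: val v])))).
Qed.

Lemma equivw_equivalent : equivw K w [::] <-> equivalent S0 S1.
Proof.
(* Thresholds are tried only below [size w], and [n] itself, which admits a whole class, must be
   among them. *)
have sz_n : n < size w.
  have := size_tree_at (tree_at_child (at_sys (isT : 0 < 2)) (isT : 4 < 5)).
  by rewrite size_map size_enum_ord.
split.
- move=> /allP H C C'; suff e : succ S0 C = succ S1 C by rewrite /phase_arc e.
  apply/ffunP => v.
  have vi : val v \in iota 0 (arity w (child w (child w 0 0) 4)).
    by rewrite mem_iota arity_nodes_sys add0n ltn_ord.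
  have /allvecP Hv := H _ vi.
  pose cnt a := #|[set u | C u && (cell_of v u == a)]|.
  pose g a m := #|[set u : 'I_n | (u < m) && (cell_of v u == a)]|.
  have thr a : exists2 m, m <= n & g a m = cnt a.
    apply: nat_ivt.
    + by apply/eqP; rewrite cards_eq0; apply/eqP/setP => u; rewrite !inE.
    + move=> m; have [lt|ge] := ltnP m n.
        rewrite /g; apply: leq_trans (_ : #|Ordinal lt |: [set u : 'I_n | (u < m) && (cell_of v
            u == a)]| <= _).
          apply/subset_leq_card/subsetP => u; rewrite !inE ltnS leq_eqVlt -val_eqE /=.
          by case/andP => /orP[->|-> ->]; rewrite ?orbT.
        by rewrite cardsU1; case: (_ \notin _); rewrite ?add1n ?add0n.
      rewrite /g; apply: leqW; apply/subset_leq_card/subsetP => u; rewrite !inE.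
      by case/andP => _ ->; rewrite (leq_trans (ltn_ord u)).
    + by apply/subset_leq_card/subsetP => u; rewrite !inE ltn_ord => /andP[].
  pose T a := find (fun m => g a m == cnt a) (iota 0 n.+1).
  have TP a : T a <= n /\ g a (T a) = cnt a.
    have [m lm e] := thr a.
    have h : has (fun m => g a m == cnt a) (iota 0 n.+1).
      by apply/hasP; exists m; rewrite ?mem_iota ?e.
    have := h; rewrite has_find size_iota => lt; split; first exact: lt.
    by have /eqP := nth_find 0 h; rewrite nth_iota // add0n.
  pose t := mkseq T (ncells K).
  have szt : size t = ncells K by rewrite size_mkseq.
  have allt : all (fun x => x < size w) t.
    by apply/allP => _ /mapP[a _ ->]; apply: leq_ltn_trans sz_n; case: (TP a).
  have {Hv} := Hv t szt allt; rewrite !valw_at //= => /eqP.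
  (* The threshold configuration need not be [C]: it only has as many 1's in each class of [v], so
     agreement is claimed at [v] alone. *)
  suff same b : b < 2 -> succ (sys b) (threshold_config t v) v = succ (sys b) C v.
    by rewrite (same 0) // (same 1).
  move=> b2; rewrite !ffunE; congr nth; apply: eq_bigr => i _; congr (nat_of_bool _ * _).
  rewrite /local_val; congr nth.
  have split (D : config n) : #|[set u in cnbhd i v | D u]| =
      \sum_(a < ncells K) #|[set u in cnbhd i v | D u && (cell_of v u == a)]|.
    rewrite -sum1_card (partition_big (fun u => Ordinal (cell_lt v u)) xpredT) //=.
    apply: eq_bigr => a _; rewrite sum1dep_card; apply: eq_card => u.
    by rewrite !inE -val_eqE /= -!andbA.
  rewrite !split; apply: eq_bigr => a _.
  (* By [cell_nbhd] a class that meets the neighborhood lies inside it, and its count is the one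
     fixed by [T]; otherwise both sides are 0. *)
  have [/existsP[u0 /andP[u0N /eqP u0a]]|no] := boolP [exists u, (u \in cnbhd i v) && (cell_of
      v u == a)].
    have full (D : config n) : [set u in cnbhd i v | D u && (cell_of v u == a)] =
          [set u | D u && (cell_of v u == a)].
      apply/setP => u; rewrite !inE; case: (cell_of v u =P a) => [ua|]; rewrite ?andbF //.
      by have := cell_nbhd i b2 (etrans u0a (esym ua)); rewrite u0N inE => <-.
    rewrite !full -/(cnt a) -(proj2 (TP a)); apply: eq_card => u; rewrite !inE ffunE.
    case: (cell_of v u =P a) => [ua|]; rewrite ?andbF // ua nth_mkseq //.
  apply: eq_card => u; rewrite !inE; move/existsPn: no => /(_ u).
  by rewrite inE; case: (_ || _) => //=; case: (_ == _); rewrite ?andbF.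
- move=> H; apply/allP => v; rewrite mem_iota arity_nodes_sys add0n => lv.
  apply/allvecP => t szt _; rewrite (valw_at (Ordinal lv) (isT : 0 < 2) szt) (valw_at (Ordinal
      lv) (isT : 1 < 2) szt).
  have := H (threshold_config t (Ordinal lv)) (succ S0 (threshold_config t (Ordinal lv))).
  by rewrite /phase_arc eqxx => /esym/eqP->.
Qed.

End Correctness.

Theorem theorem5p1 (K : nat) :
  1 <= K ->
  exists (M : TM) (c d : nat),
    forall (n : nat) (S0 S1 : msyds n),
      wf_msyds S0 -> wf_msyds S1 ->
      nlayers S0 <= K -> nlayers S1 <= K ->
      tm_decides_within M (enc_instance S0 S1)
        (c * (size (enc_instance S0 S1)).+1 ^ d)
        (equivalent S0 S1).
Proof.
move=> _; have [M [c [d H]]] := decb_decides (decb_equivw K).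
exists M, c, d => n S0 S1 wf0 wf1 K0 K1.
(* The encoding starts with an opening token, so the input is nonempty. *)
have [//|q e a] := H (enc_instance S0 S1).
by exists q; split=> //; rewrite a; apply: equivw_equivalent.
Qed.
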